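(* Let $\mu,\nu$ be Radon measures on $\mathbb{R}$, both globally doubling, and assume that for some $C\geq 1$, $$\int_{B(x,2r)}\int_0^{2r}\alpha^2_{\mu,\nu}(B(y,t))\,\frac{dt\,d\mu(y)}{t} \leq C\mu(B(x,r)) \qquad\text{for all } x\in\mathbb{R},\ r>0,$$ where $B(x,r) = (x-r,x+r)$. Then $\mu\in A_\infty(\nu)$, i.e. there is $p<\infty$ such that the maximal operator $M_\nu f(x) = \sup_{I\ni x}\frac{1}{\nu(I)}\int_I|f|\,d\nu$ (supremum over intervals $I$ containing $x$) is bounded on $L^p(\mu)$.
   Context: A measure $\sigma$ on $\mathbb{R}$ is globally doubling if $\sigma(B(x,2r))\le C\sigma(B(x,r))$ for all $x\in\mathbb{R}$, $r>0$. Wasserstein distance: $\mathbb{W}_1(\nu_1,\nu_2) := \sup_\psi |\int\psi\,d\nu_1 - \int\psi\,d\nu_2|$ over all $1$-Lipschitz $\psi\colon\mathbb{R}\to\mathbb{R}$ supported on $[0,1]$. For an interval $I$, $T_I$ is the increasing affine map taking $\overline I$ onto $[0,1]$, $\mu_I := T_{I\sharp}(\mu|_I)/\mu(I)$, $\nu_I := T_{I\sharp}(\nu|_I)/\nu(I)$, and $\alpha_{\mu,\nu}(I) := \mathbb{W}_1(\mu_I,\nu_I)$. *)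

(* Defs.v *)
From HB Require Import structures.
From mathcomp Require Import all_boot all_order all_algebra.
From mathcomp Require Import all_classical all_reals all_analysis.
Set Implicit Arguments. Unset Strict Implicit. Unset Printing Implicit Defensive.
Import Order.TTheory GRing.Theory Num.Theory.
Import numFieldNormedType.Exports.
Local Open Scope classical_set_scope.
Local Open Scope ring_scope.

Section defs.
Context {R : realType}.

Definition oball (x r : R) : set R := `]x - r, x + r[%classic.

Definition radon (mu : {measure set R -> \bar R}) : Prop :=
  forall x r, (mu (oball x r) < +oo)%E.

Definition doubling (mu : {measure set R -> \bar R}) : Prop :=
  exists C : R, forall x r, 0 < r -> (mu (oball x (2 * r)) <= C%:E * mu (oball x r))%E.

Definition TI (a b : R) (y : R) : R := (y - a) / (b - a).

Definition normpush (mu : {measure set R -> \bar R}) (a b : R) : set R -> \bar R :=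
  fun A => (((fine (mu `]a, b[%classic))^-1)%:E *
           pushforward (fun X => mu (X `&` `]a, b[%classic)) (TI a b) A)%E.

Definition lip1_01 (psi : R -> R) : Prop :=
  (forall u v, `|psi u - psi v| <= `|u - v|) /\
  (forall u, ~ (`[0, 1]%classic u) -> psi u = 0).

Definition W1 (m1 m2 : set R -> \bar R) : \bar R :=
  ereal_sup [set `| (\int[m1]_x (psi x)%:E - \int[m2]_x (psi x)%:E)%E |%E
            | psi in lip1_01].

Definition alpha (mu nu : {measure set R -> \bar R}) (a b : R) : \bar R :=
  W1 (normpush mu a b) (normpush nu a b).

Definition maxop (nu : {measure set R -> \bar R}) (f : R -> R) (x : R) : \bar R :=
  ereal_sup [set (((fine (nu `]ab.1, ab.2[%classic))^-1)%:E *
                   \int[nu]_(y in `]ab.1, ab.2[%classic) (`|f y|)%:E)%E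
            | ab in [set ab : R * R | ab.1 < x < ab.2]].

End defs.

(* Main.v *)
Require Import Defs.
From HB Require Import structures.
From mathcomp Require Import all_boot all_order all_algebra.
From mathcomp Require Import all_classical all_reals all_analysis.
From mathcomp Require Import measurable_realfun ring lra.
Import Order.TTheory GRing.Theory Num.Theory.
Import numFieldNormedType.Exports.
Local Open Scope classical_set_scope.
Local Open Scope ring_scope.

(** Let [hat x h] be the tent function of width [h] centred at [x]. The two-scale identity
    hat x h = hat (x - h/2) (h/2) / 2 + hat x (h/2) + hat (x + h/2) (h/2) / 2 turns the
    masses M(x,h) = int hat dmu and N(x,h) = int hat dnu into two Markov chains on nodes
    (x,h), with transition probabilities p_i and q_i. As tents are Lipschitz, |p_i - q_i| is
    bounded by alpha on comparable intervals, with no sharp cut-offs involved, so the chi-square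
    divergences a = sum_i p_i (q_i/p_i - 1)^2 satisfy a Carleson condition: their expected sum
    along the mu-chain, started at any node, is at most some K. A Bellman function
    argument (with potential 2 - exp (- theta b), b being the expected remaining sum) gives a
    reverse Hoelder inequality for N/M along the chain with exponent 1 + eps.
    This yields nu(E) / N <= l mu(E) / M + 2 l^(-eps) for all l > 0 (masses weighted by the hat),
    first for open E, then for Borel E by outer regularity. A layer-cake summation over dyadic
    levels with l = (4 2^k)^P, P eps >= 2, gives a weak-type (P+1,P+1) bound for [maxop nu]
    with respect to mu by Vitali covering, and summing over dyadic levels gives the strong
    type (P+2,P+2). *)

Set Implicit Arguments. Unset Strict Implicit. Unset Printing Implicit Defensive.

(** * The one-step Bellman inequality *)

Section bellman.
Context {R : realType}.
Implicit Types (x e r : R).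

(** The obstacle is that the Carleson condition controls the sum of the divergences only on average,
    not along each path. Under the mu-chain N/M is a martingale, and one step multiplies the mean of
    (N/M)^(1+eps) by at most 1 + eps a; multiplying these factors along a path would call for
    exponential moments of the sum. The expected remaining sum b is therefore carried as a second
    state variable, through the factor 2 - exp (- theta b), which stays between 1 and 2. A step that
    spends a lowers the mean of b by a, and the resulting drop of the factor pays for the growth by
    1 + eps a.

    Tents are forced by the Wasserstein distance, which tests Lipschitz functions only and so does
    not compare the masses of an interval and of its halves. Their price is overlap: the nodes form
    a tree but not a filtration of the line, so a set is followed through tent-weighted masses,
    which obey the same two-scale identity.

    Since [alpha] is not known to be measurable, it is only ever bounded below by measurable
    functions. *)

Lemma powR_le_bernoulli r e : 0 < r -> 0 < e -> e < 1 -> r `^ e <= 1 + e * (r - 1).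
Proof.
move=> r0 e0 e1.
have e1' : 0 < 1 - e by rewrite subr_gt0.
(* Young's inequality for the product of r^e and 1, with exponents 1/e and 1/(1-e). *)
have := @conjugate_powR R (r `^ e) 1 e^-1 (1 - e)^-1 (powR_ge0 _ _) ler01.
have h1 : e + (1 - e) = 1 by lra.
rewrite !invr_gt0 => /(_ e0 e1'); rewrite !invrK => /(_ h1).
by rewrite -powRrM mulfV ?gt_eqF// powRr1 ?(ltW r0)// powR1 mulr1 => h; lra.
Qed.

Lemma powR_ge_bernoulli r e : 0 < r -> 0 <= e -> 1 + (1 + e) * (r - 1) <= r `^ (1 + e).
Proof.
move=> r0 e0.
have -> : r `^ (1 + e) = r * r `^ e.
  by rewrite powRD ?powRr1 ?(ltW r0)// (gt_eqF r0) implybT.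
have lnr : 1 - r^-1 <= ln r.
  have rV : -1 < r^-1 - 1 by rewrite ltrBrDl subrr invr_gt0.
  have := le_ln1Dx rV; rewrite addrCA subrr addr0 lnV ?posrE//; lra.
have h1 : 1 + e * (1 - r^-1) <= r `^ e.
  rewrite /powR gt_eqF//; apply: le_trans (expR_ge1Dx _).
  by rewrite lerD2l ler_wpM2l.
have := ler_wpM2l (ltW r0) h1.
rewrite mulrDr mulr1 [r * (e * _)]mulrCA mulrBr mulr1 mulfV ?gt_eqF//; lra.
Qed.

Lemma invr1D_le (y d : R) : 0 < d -> d <= 1 + y -> (1 + y)^-1 <= 1 - y + d^-1 * y ^+ 2.
Proof.
move=> d0 dy; have y0 : 0 < 1 + y by lra.
have -> : (1 + y)^-1 = 1 - y + (1 + y)^-1 * y ^+ 2 by field; rewrite gt_eqF.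
by rewrite lerD2l ler_wpM2r ?sqr_ge0// lef_pV2.
Qed.

Lemma expRN_le (t : R) : 0 <= t -> expR (- t) <= (1 + t)^-1.
Proof.
move=> t0; rewrite expRN lef_pV2 ?posrE ?expR_gt0 ?expR_ge1Dx//.
by lra.
Qed.

(* Cauchy-Schwarz for [sqrt (p u) s] and [sqrt (p / u)], combined with Jensen for [expR (- x / 2)]. *)
Lemma weighted_expRN_ge (I : finType) (p u x : I -> R) (S : R) :
  (forall i, 0 <= p i) -> \sum_i p i = 1 -> (forall i, 0 < u i) ->
  \sum_i p i * x i = 0 -> 0 < S -> \sum_i p i * (u i)^-1 <= S ->
  S^-1 <= \sum_i p i * (u i * expR (- x i)).
Proof.
move=> p0 p1 u0 px S0 pu.
have h i : p i * (2 * S^-1 * (1 - x i / 2)) - S^-1 ^+ 2 * (p i * (u i)^-1)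
    <= p i * (u i * expR (- x i)).
  have -> : expR (- x i) = expR (- x i / 2) ^+ 2.
    by rewrite -expRM_natr; congr expR; field.
  set s := expR (- x i / 2).
  have sx : 1 - x i / 2 <= s by have := expR_ge1Dx (- x i / 2); rewrite -/s; lra.
  (* The Cauchy-Schwarz step is linearised: this is (u s - 1/S)^2 >= 0 divided by u, with the
     multiplier 1/S chosen so that the sum comes out as 2/S - 1/S. *)
  have hs : 2 * S^-1 * s - S^-1 ^+ 2 * (u i)^-1 <= u i * s ^+ 2.
    have -> : u i * s ^+ 2 = (u i * s) ^+ 2 * (u i)^-1.
      by field; rewrite gt_eqF.
    have -> : 2 * S^-1 * s = (2 * S^-1 * (u i * s)) * (u i)^-1.
      by field; rewrite !gt_eqF.
    rewrite -mulrBl ler_pM2r ?invr_gt0//.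
    by have := sqr_ge0 (u i * s - S^-1); nra.
  have S2 : 0 <= 2 * S^-1 by rewrite mulr_ge0// ltW// invr_gt0.
  have := ler_wpM2l S2 sx => {}sx.
  have := ler_wpM2l (p0 i) (le_trans (lerB sx (lexx _)) hs).
  by rewrite mulrBr; lra.
apply: le_trans (ler_sum _ (fun i _ => h i)).
rewrite sumrB -mulr_sumr.
have -> : \sum_i p i * (2 * S^-1 * (1 - x i / 2)) = 2 * S^-1.
  rewrite (eq_bigr (fun i => 2 * S^-1 * p i - S^-1 * (p i * x i))).
    by rewrite sumrB -!mulr_sumr px p1 mulr0 subr0 mulr1.
  by move=> i _; field; rewrite gt_eqF.
have : S^-1 ^+ 2 * (\sum_i p i * (u i)^-1) <= S^-1 ^+ 2 * S by rewrite ler_wpM2l ?sqr_ge0.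
have -> : S^-1 ^+ 2 * S = S^-1 by field; rewrite gt_eqF.
lra.
Qed.

(** The part 8/c matches the loss 1 + (8/c) a of the Cauchy-Schwarz estimate: 2/c from [invr1D_le]
    times (1+e)^2 <= 4. The extra 1 leaves a surplus proportional to a. *)
Definition bellman_theta (c : R) := 1 + 8 / c.
(** The bound c/2 keeps the tangent values 1 + (1+e)(r-1) above c/2 when r >= c. The other bound
    makes 2 e a at most the surplus left by [bellman_theta], for a <= A and a mean of b at most
    K. *)
Definition bellman_eps (c A K : R) :=
  Num.min (c / 2) (expR (- (bellman_theta c * K)) / (2 * (1 + bellman_theta c * A) ^+ 2)).

Lemma bellman_eps_gt0 c A K : 0 < c -> 0 <= A -> 0 < bellman_eps c A K.
Proof.
move=> c0 A0; rewrite /bellman_eps lt_min divr_gt0//= divr_gt0 ?expR_gt0//.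
rewrite mulr_gt0// exprn_gt0// ltr_wpDr// mulr_ge0//.
by rewrite /bellman_theta addr_ge0// divr_ge0// ltW.
Qed.

(** The mean of r_i^(1+e) grows by at most e a. The danger is a correlation of r_i with b_i, since
    the exponentials are averaged with weights p_i r_i^(1+e) while b is averaged under p_i.
    Cauchy-Schwarz bounds that loss by a factor 1 + (8/c) a, which the term a added to the mean of b
    on the right more than repays. *)
Lemma bellman_step (I : finType) (p r b : I -> R) (c A K : R)
    (th := bellman_theta c) (e := bellman_eps c A K) (a := \sum_i p i * (r i - 1) ^+ 2) :
  0 < c -> c <= 1 -> a <= A -> 0 <= K ->
  (forall i, 0 <= p i) -> \sum_i p i = 1 -> \sum_i p i * r i = 1 ->
  (forall i, c <= r i) -> (forall i, b i <= K) ->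
  \sum_i p i * (r i `^ (1 + e) * (2 - expR (- (th * b i)))) <=
  2 - expR (- (th * (a + \sum_i p i * b i))).
Proof.
move=> c0 c1 aA K0 p0 p1 pr cr bK.
have a0 : 0 <= a by apply: sumr_ge0 => i _; rewrite mulr_ge0 ?sqr_ge0.
have A0 : 0 <= A by lra.
have e0 : 0 < e by exact: bellman_eps_gt0.
have ec : e <= c / 2 by rewrite /e /bellman_eps ge_min lexx.
have eE : e <= expR (- (th * K)) / (2 * (1 + th * A) ^+ 2).
  by rewrite /e /bellman_eps ge_min lexx orbT.
have th0 : 0 < th by rewrite /th /bellman_theta ltr_pwDl// divr_ge0// ltW.
clearbody e.
have r0 i : 0 < r i by exact: lt_le_trans (cr i).
have pr1 : \sum_i p i * (r i - 1) = 0.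
  under eq_bigr do rewrite mulrBr mulr1.
  by rewrite sumrB pr p1 subrr.
pose bb := \sum_i p i * b i; rewrite -/bb.
have bbK : bb <= K.
  rewrite -[K]mul1r -p1 mulr_suml; apply: ler_sum => i _.
  by rewrite ler_wpM2l.
(* The tangent to r^(1+e) at r = 1: a lower bound with mean 1, whose inverse has mean at most 1 +
   (8/c) a. *)
pose u i := 1 + (1 + e) * (r i - 1).
have cu i : c / 2 <= u i by have := cr i; rewrite /u; nra.
have u0 i : 0 < u i by apply: lt_le_trans (cu i); rewrite divr_gt0.
pose x i := th * (b i - bb).
have px : \sum_i p i * x i = 0.
  rewrite (eq_bigr (fun i => th * (p i * b i) - th * bb * p i)).
    by rewrite sumrB -!mulr_sumr p1 mulr1 subrr.
  by move=> i _; rewrite /x; ring.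
pose C := 8 / c.
have C0 : 0 < C by rewrite divr_gt0.
have thC : th = 1 + C by [].
have S0 : 0 < 1 + C * a by rewrite ltr_wpDr// mulr_ge0// ltW.
have pu : \sum_i p i * (u i)^-1 <= 1 + C * a.
  have h i : p i * (u i)^-1 <= p i - (1 + e) * (p i * (r i - 1)) + C * (p i * (r i - 1) ^+ 2).
    have c20 : 0 < c / 2 by rewrite divr_gt0.
    have := ler_wpM2l (p0 i) (invr1D_le c20 (cu i)).
    move=> /le_trans; apply.
    have -> : (c / 2)^-1 = 2 / c by field; rewrite gt_eqF.
    have -> : p i * (1 - (1 + e) * (r i - 1) + 2 / c * ((1 + e) * (r i - 1)) ^+ 2) =
      p i - (1 + e) * (p i * (r i - 1)) +
      (2 / c * (1 + e) ^+ 2) * (p i * (r i - 1) ^+ 2) by ring.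
    rewrite lerD2l.
    apply: ler_wpM2r; first by rewrite mulr_ge0 ?sqr_ge0.
    have -> : C = 2 / c * 4 by rewrite /C; ring.
    rewrite ler_pM2l ?divr_gt0//; nra.
  apply: (le_trans (ler_sum _ (fun i _ => h i))).
  by rewrite big_split sumrB/= -!mulr_sumr p1 pr1 mulr0 subr0 -/a.
have := weighted_expRN_ge p0 p1 u0 px S0 pu => key.
have rE i : r i `^ (1 + e) = r i * r i `^ e.
  by rewrite powRD ?powRr1 ?(ltW (r0 i))// (gt_eqF (r0 i)) implybT.
(* Bernoulli gives r^(1+e) <= r + e ((r-1)^2 + (r-1)); the linear term averages to 0 and the square
   to a. *)
have first_part : \sum_i p i * r i `^ (1 + e) <= 1 + e * a.
  have h i : p i * r i `^ (1 + e) <= p i * r i + e * (p i * (r i - 1) ^+ 2 + p i * (r i - 1)).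
    rewrite rE.
    have e1 : e < 1 by lra.
    have := ler_wpM2l (mulr_ge0 (p0 i) (ltW (r0 i))) (powR_le_bernoulli (r0 i) e0 e1).
    by rewrite -mulrA => /le_trans; apply; rewrite le_eqVlt; apply/orP; left; apply/eqP; ring.
  apply: (le_trans (ler_sum _ (fun i _ => h i))).
  by rewrite big_split/= -mulr_sumr big_split/= pr pr1 addr0.
have second_part : expR (- (th * bb)) * (1 + C * a)^-1 <=
    \sum_i p i * (r i `^ (1 + e) * expR (- (th * b i))).
  have h i : expR (- (th * bb)) * (p i * (u i * expR (- x i))) <=
     p i * (r i `^ (1 + e) * expR (- (th * b i))).
    have -> : expR (- (th * b i)) = expR (- (th * bb)) * expR (- x i).
      by rewrite -expRD; congr expR; rewrite /x; ring.
    rewrite mulrCA; apply: ler_wpM2l => //.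
    rewrite [leRHS]mulrCA; apply: ler_wpM2l; first exact: expR_ge0.
    by apply: ler_wpM2r; [exact: expR_ge0|exact: powR_ge_bernoulli (ltW e0)].
  apply: le_trans (ler_sum _ (fun i _ => h i)).
  by rewrite -mulr_sumr ler_wpM2l ?expR_ge0.
have -> : \sum_i p i * (r i `^ (1 + e) * (2 - expR (- (th * b i)))) =
   2 * (\sum_i p i * r i `^ (1 + e)) - \sum_i p i * (r i `^ (1 + e) * expR (- (th * b i))).
  by rewrite mulr_sumr -sumrB; apply: eq_bigr => i _; ring.
have -> : expR (- (th * (a + bb))) = expR (- (th * bb)) * expR (- (th * a)).
  by rewrite -expRD; congr expR; ring.
have h3 := expRN_le (mulr_ge0 (ltW th0) a0).
have h4 : expR (- (th * K)) <= expR (- (th * bb)).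
  by rewrite ler_expR lerN2 ler_pM2l.
have tA : 0 < 1 + th * A by rewrite ltr_wpDr// mulr_ge0// ltW.
have ta : 0 < 1 + th * a by rewrite ltr_wpDr// mulr_ge0// ltW.
(* The surplus: as theta - 8/c = 1, the difference is exactly a over the product of the two
   denominators. *)
have h5 : a / (1 + th * A) ^+ 2 <= (1 + C * a)^-1 - (1 + th * a)^-1.
  have -> : (1 + C * a)^-1 - (1 + th * a)^-1 = a * ((1 + C * a) * (1 + th * a))^-1.
    rewrite thC; field; rewrite -?thC; apply/andP; split; rewrite gt_eqF//.
  rewrite ler_wpM2l// lef_pV2 ?posrE ?mulr_gt0 ?exprn_gt0// expr2.
  apply: ler_pM; [exact: ltW|exact: ltW| |]; rewrite lerD2l.
    by apply: ler_pM => //; [exact: ltW|rewrite thC; lra].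
  by rewrite ler_pM2l.
have h6 : 2 * (e * a) <= expR (- (th * bb)) * (a / (1 + th * A) ^+ 2).
  have : expR (- (th * K)) / (2 * (1 + th * A) ^+ 2) * (2 * a) <=
     expR (- (th * bb)) / (2 * (1 + th * A) ^+ 2) * (2 * a).
    rewrite ler_wpM2r ?mulr_ge0// ler_wpM2r// invr_ge0 mulr_ge0// exprn_ge0//.
    exact: ltW.
  have := ler_wpM2r (mulr_ge0 (ler0n _ 2) a0) eE.
  have -> : expR (- (th * bb)) / (2 * (1 + th * A) ^+ 2) * (2 * a) =
    expR (- (th * bb)) * (a / (1 + th * A) ^+ 2) by field; rewrite gt_eqF.
  rewrite mulrCA; lra.
have := ler_wpM2l (expR_ge0 (- (th * bb))) h5.
have := ler_wpM2l (expR_ge0 (- (th * bb))) h3.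
move: first_part second_part h6; rewrite mulrBr; lra.
Qed.

End bellman.

(** * Chains of refinements *)

Section refinement.
Context {R : realType}.
Implicit Types (x h s : R) (F G : R -> R -> R) (i : 'I_3).

(* The node [(x, h)] has three children [(child x h i, h / 2)], with the weights 1/2, 1, 1/2
   of the two-scale identity for tent functions. *)
Definition wt i : R := if i == 1 :> nat then 1 else 2^-1.
Definition child x h i : R := x + (i%:R - 1) * (h / 2).
Definition refine F x h : R := \sum_i wt i * F (child x h i) (h / 2).
Definition transition F x h i : R := wt i * F (child x h i) (h / 2) / F x h.

Lemma wt_ge0 i : 0 <= wt i.
Proof. by rewrite /wt; case: ifP. Qed.

Lemma wt_le1 i : wt i <= 1.
Proof. by rewrite /wt; case: ifP => // _; lra. Qed.

Lemma ler_refine F G x h : 0 < h ->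
  (forall y, F y (h / 2) <= G y (h / 2)) -> refine F x h <= refine G x h.
Proof. by move=> h0 FG; apply: ler_sum => i _; rewrite ler_wpM2l ?wt_ge0. Qed.

(* [cumul F D k x h / F x h] is the expected sum of [D] over the first [k] nodes of the chain
   with the transition probabilities of [F] started at [(x, h)]. *)
Fixpoint cumul F (D : R -> R -> R) k x h : R :=
  if k is k'.+1 then F x h * D x h + refine (cumul F D k') x h else 0.

(** Applied to M times f and divided by M at the root, this is the expectation of f after k steps of
    the M-chain. *)
Fixpoint refine_iter F k x h : R :=
  if k is k'.+1 then refine (refine_iter F k') x h else F x h.

Lemma ler_refine_iter F G k x h : 0 < h ->
  (forall y g, 0 < g -> F y g <= G y g) -> refine_iter F k x h <= refine_iter G k x h.
Proof.
move=> + FG; elim: k x h => [|k IH] x h h0 /=; first exact: FG.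
by apply: ler_refine => // y; apply: IH; rewrite divr_gt0.
Qed.

Lemma refine_iterD F G (s t : R) k x h :
  refine_iter (fun y g => s * F y g + t * G y g) k x h =
  s * refine_iter F k x h + t * refine_iter G k x h.
Proof.
elim: k x h => [//|k IH] x h /=; rewrite !mulr_sumr -big_split /=.
by apply: eq_bigr => i _; rewrite IH; ring.
Qed.

Definition refining F (c : R) : Prop :=
  forall x h, 0 < h ->
    [/\ 0 < F x h, refine F x h = F x h & forall i, c <= transition F x h i].

Variables (M N : R -> R -> R) (c : R).
Hypotheses (rM : refining M c) (rN : refining N c) (c0 : 0 < c).

Definition chi2 x h : R := \sum_i transition M x h i *
   (transition N x h i / transition M x h i - 1) ^+ 2.

Lemma refining_sum F x h : refining F c -> 0 < h -> \sum_i transition F x h i = 1.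
Proof.
move=> rF h0; have [F0 FE _] := rF x h h0.
rewrite -mulr_suml; rewrite [X in X / _](_ : _ = F x h); last by rewrite -[RHS]FE.
by rewrite mulfV ?gt_eqF.
Qed.

Lemma refining_le1 F x h i : refining F c -> 0 < h -> transition F x h i <= 1.
Proof.
move=> rF h0; rewrite -(refining_sum x rF h0) (bigD1 i)//= lerDl.
by apply: sumr_ge0 => j _; have [_ _ cF] := rF x h h0; exact: le_trans (ltW c0) (cF j).
Qed.

Lemma chi2_ge0 x h : 0 < h -> 0 <= chi2 x h.
Proof.
move=> h0; have [_ _ cM] := rM x h0.
by apply: sumr_ge0 => i _; rewrite mulr_ge0 ?sqr_ge0// (le_trans (ltW c0)).
Qed.

Lemma chi2_le_diff x h : 0 < h ->
  chi2 x h <= c^-1 * \sum_i (transition N x h i - transition M x h i) ^+ 2.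
Proof.
move=> h0; have [_ _ cM] := rM x h0.
rewrite mulr_sumr; apply: ler_sum => i _.
have p0 : 0 < transition M x h i := lt_le_trans c0 (cM i).
have -> : transition M x h i * (transition N x h i / transition M x h i - 1) ^+ 2 =
  (transition M x h i)^-1 * (transition N x h i - transition M x h i) ^+ 2.
  by field; rewrite gt_eqF.
by apply: ler_wpM2r; rewrite ?sqr_ge0// lef_pV2 ?posrE.
Qed.

Lemma chi2_le x h : 0 < h -> chi2 x h <= 3 * c^-1.
Proof.
move=> h0; apply: (le_trans (chi2_le_diff x h0)).
rewrite mulrC; apply: ler_wpM2r; first by rewrite invr_ge0 ltW.
have h1 i : (transition N x h i - transition M x h i) ^+ 2 <= 1.
  have [_ _ cM] := rM x h0; have [_ _ cN] := rN x h0.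
  have := cM i; have := cN i.
  have := refining_le1 x i rM h0; have := refining_le1 x i rN h0.
  move: c0; set p := transition _ _ _ _; set p' := transition _ _ _ _; nra.
by apply: (le_trans (ler_sum _ (fun i _ => h1 i))); rewrite sumr_const card_ord.
Qed.

Variable K : R.
Hypothesis (Kbound : forall k x h, 0 < h -> cumul M chi2 k x h <= K * M x h).

Let A : R := 3 * c^-1.
Let e := bellman_eps c A K.
Let th := bellman_theta c.

Let potential x h := M x h * (N x h / M x h) `^ (1 + e).

Lemma carleson_reverse_hoelder k x h : 0 < h ->
  refine_iter potential k x h <= 2 * potential x h.
Proof.
move=> h0.
have c1 : c <= 1.
  by have [_ _ /(_ ord0)] := rM 0 ltr01; move/le_trans; apply; exact: refining_le1.
have K0 : 0 <= K.
  by have := @Kbound 0%N 0 1 ltr01; rewrite /= -ler_pdivrMr ?mul0r//; have [] := rM 0 ltr01.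
(* Strengthened for the induction: the factor is 1 when no step remains and never exceeds 2. Its
   argument satisfies b = a + sum_i p_i b_i, as [bellman_step] requires. *)
suff : refine_iter potential k x h <=
    potential x h * (2 - expR (- (th * (cumul M chi2 k x h / M x h)))).
  move=> /le_trans; apply; rewrite mulrC ler_wpM2r//; last by rewrite lerBlDr lerDl expR_ge0.
  by rewrite mulr_ge0 ?powR_ge0//; have [/ltW] := rM x h0.
elim: k x h h0 => [|k IH] x h h0 /=.
  by rewrite mul0r mulr0 oppr0 expR0 (_ : 2 - 1 = 1) ?mulr1//; lra.
have h20 : 0 < h / 2 by rewrite divr_gt0.
have [M0 ME cM] := rM x h0; have [N0 NE cN] := rN x h0.
pose p := transition M x h.
pose r i := transition N x h i / transition M x h i.
pose b i := cumul M chi2 k (child x h i) (h / 2) / M (child x h i) (h / 2).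
have p0 i : 0 < p i := lt_le_trans c0 (cM i).
have M0' i : 0 < M (child x h i) (h / 2) by have [] := rM (child x h i) h20.
have cr i : c <= r i.
  rewrite /r ler_pdivlMr ?p0//; apply: le_trans (cN i).
  by rewrite -[leRHS]mulr1 ler_wpM2l ?(ltW c0) ?refining_le1.
have pr : \sum_i p i * r i = 1.
  rewrite -(refining_sum x rN h0); apply: eq_bigr => i _.
  by rewrite /r /p mulrC divfK// gt_eqF// p0.
have bK i : b i <= K by rewrite /b ler_pdivrMr// Kbound.
have := @bellman_step _ _ p r b c A K c0 c1 (chi2_le x h0) K0 (fun i => ltW (p0 i))
  (refining_sum x rM h0) pr cr bK.
rewrite -/e -/th => /(ler_wpM2l (mulr_ge0 (ltW M0) (powR_ge0 (N x h / M x h) (1 + e)))).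
rewrite -/(potential x h); have -> : \sum_i p i * (r i - 1) ^+ 2 + \sum_i p i * b i =
   (M x h * chi2 x h + refine (cumul M chi2 k) x h) / M x h.
  rewrite mulrDl mulrAC mulfV ?gt_eqF// mul1r; congr +%R.
  rewrite /refine mulr_suml; apply: eq_bigr => i _; rewrite /p /b /transition.
  by field; rewrite !gt_eqF.
apply: le_trans; rewrite mulr_sumr; apply: ler_sum => i _.
apply: (le_trans (ler_wpM2l (wt_ge0 i) (IH _ _ h20))).
have zE : N (child x h i) (h / 2) / M (child x h i) (h / 2) = (N x h / M x h) * r i.
  rewrite /r /transition; field; rewrite !gt_eqF//=.
  by have := p0 i; rewrite /p /transition pmulr_lgt0 ?invr_gt0// pmulr_lgt0.
have r0 : 0 <= r i := le_trans (ltW c0) (cr i).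
have Z0 : 0 <= N x h / M x h by rewrite divr_ge0 ?ltW.
rewrite /potential zE powRM//.
rewrite -/(b i) /p /transition le_eqVlt; apply/orP; left; apply/eqP.
by field; rewrite gt_eqF.
Qed.

(** Node by node, with z = N/M: if z <= s then N <= s M, and otherwise z <= s^(-e) z^(1+e), whose
    total is bounded by the reverse Hoelder inequality. [L] is an arbitrary selection of leaves. *)
Lemma carleson_linear_bound (L : R -> R -> bool) (s : R) k x h : 0 < h -> 0 < s ->
  refine_iter (fun y g => if L y g then N y g else 0) k x h <=
  s * refine_iter (fun y g => if L y g then M y g else 0) k x h +
  s `^ (- e) * (2 * potential x h).
Proof.
move=> h0 s0.
have : s `^ (- e) * refine_iter potential k x h <= s `^ (- e) * (2 * potential x h).
  by rewrite ler_wpM2l ?powR_ge0// carleson_reverse_hoelder.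
move/(lerD (lexx (s * refine_iter (fun y g => if L y g then M y g else 0) k x h))).
apply: le_trans; rewrite -refine_iterD; apply: ler_refine_iter => // y g g0.
have [M0 _ _] := rM y g0; have [N0 _ _] := rN y g0.
have P0 : 0 <= s `^ (- e) * potential y g by rewrite !mulr_ge0 ?powR_ge0 ?(ltW M0).
case: ifP => _; last by rewrite mulr0 add0r.
set z := N y g / M y g.
have z0 : 0 < z by rewrite divr_gt0.
have -> : N y g = M y g * z by rewrite mulrC divfK ?gt_eqF.
have [zs|sz] := leP z s.
  by apply: ler_wpDr => //; rewrite mulrC ler_wpM2r// ltW.
apply: ler_wpDl; first by rewrite mulr_ge0// ltW.
rewrite /potential -/z [leRHS]mulrCA; clearbody z; apply: ler_wpM2l; first exact: ltW.
have e0 : 0 < e by apply: bellman_eps_gt0 => //; rewrite mulr_ge0// invr_ge0 ltW.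
rewrite powRD ?powRr1 ?(ltW z0)//; last by rewrite (gt_eqF z0) implybT.
rewrite mulrCA -[leLHS]mulr1; apply: ler_wpM2l; first exact: ltW.
rewrite powRN mulrC ler_pdivlMr ?powR_gt0// mul1r.
by rewrite ge0_ler_powR// ?nnegrE ltW.
Qed.

End refinement.

(** * Tent functions and their masses *)

Section hat.
Context {R : realType}.
Implicit Types (x h y : R) (A : set R) (m : {measure set R -> \bar R}).

Definition hat x h y : R := Num.max 0 (1 - `|y - x| / h).

Lemma hat_ge0 x h y : 0 <= hat x h y.
Proof. by rewrite /hat le_max lexx. Qed.

Lemma hat_le1 x h y : 0 < h -> hat x h y <= 1.
Proof.
by move=> h0; rewrite /hat ge_max ler01 gerBl divr_ge0// ltW.
Qed.

Lemma oballE x h y : oball x h y = (`|y - x| < h) :> Prop.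
Proof.
rewrite /oball /= in_itv/= ltr_norml propeqE.
by split=> /andP[? ?]; apply/andP; split; lra.
Qed.

Lemma hat_out x h y : 0 < h -> ~ oball x h y -> hat x h y = 0.
Proof.
move=> h0; rewrite oballE => /negP; rewrite -leNgt => hy.
by apply/max_idPl; rewrite subr_le0 ler_pdivlMr// mul1r.
Qed.

Lemma hat_ge x h y s : 0 < h -> oball x (s * h) y -> 1 - s <= hat x h y.
Proof.
move=> h0; rewrite oballE => hy.
by rewrite /hat le_max lerD2l lerN2 ler_pdivrMr// (ltW hy) orbT.
Qed.

Lemma hat_lip x h y z : 0 < h -> `|hat x h y - hat x h z| <= h^-1 * `|y - z|.
Proof.
move=> h0.
have : `| `|y - x| / h - `|z - x| / h | <= h^-1 * `|y - z|.
  rewrite -mulrBl normrM [`|h^-1|]gtr0_norm ?invr_gt0// mulrC ler_pM2l ?invr_gt0//.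
  apply: (le_trans (ler_dist_dist _ _)).
  by rewrite opprB addrA subrK.
rewrite /hat; set u := _ / h; set v := _ / h.
move: (h^-1 * _) => t; rewrite !ler_norml => /andP[h1 h2].
by rewrite /Num.max; case: ltP => ?; case: ltP => ?; lra.
Qed.

Lemma hat_refine x h y : 0 < h -> refine (fun x h => hat x h y) x h = hat x h y.
Proof.
move=> h0; rewrite /refine !big_ord_recl big_ord0 /wt /child /= addr0 mul1r.
rewrite /bump /= (_ : (1 + 0)%N = 1%N)// (_ : (1 + 1)%N = 2%N)// /hat.
have -> : x + (0%:R - 1) * (h / 2) = x - h / 2 by ring.
have -> : x + (1%:R - 1) * (h / 2) = x by ring.
have -> : x + (2%:R - 1) * (h / 2) = x + h / 2 by ring.
pose t := (y - x) / h.
have yx : y - x = t * h by rewrite /t divfK// gt_eqF.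
clearbody t.
have -> : y - (x - h / 2) = (t + 2^-1) * h.
  by rewrite mulrDl -yx; field.
have -> : y - (x + h / 2) = (t - 2^-1) * h.
  by rewrite mulrBl -yx; field.
rewrite yx !normrM (gtr0_norm h0).
have hh z : z * h / (h / 2) = 2 * z by field; rewrite gt_eqF.
rewrite !hh mulfK ?gt_eqF// /Num.max.
have P (z : R) : (0 <= z /\ `|z| = z) \/ (z < 0 /\ `|z| = - z).
  by have [z0|z0] := leP 0 z; [left; rewrite ger0_norm|right; rewrite ltr0_norm].
case: (P t) => -[? ->]; case: (P (t + 2^-1)) => -[? ->]; case: (P (t - 2^-1)) => -[? ->];
case: ltP => ?; case: ltP => ?; case: ltP => ?; case: ltP => ?; lra.
Qed.

Lemma measurable_hat x h : measurable_fun setT (hat x h).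
Proof.
apply: (@measurable_maxr _ _ _ _ (cst 0) (fun y => 1 - `|y - x| / h)); first exact: measurable_cst.
apply: measurable_funB; first exact: measurable_cst.
apply: measurable_funM; last exact: measurable_cst.
apply: measurableT_comp; first exact: normr_measurable.
by apply: measurable_funB; [exact: measurable_id|exact: measurable_cst].
Qed.

Lemma measurable_Ehat A x h : measurable_fun A (fun y => (hat x h y)%:E).
Proof.
apply: (@measurable_funS _ _ _ _ setT) => //.
by apply/measurable_EFinP; exact: measurable_hat.
Qed.

Lemma measurable_oball x h : measurable (oball x h).
Proof. exact: measurable_itv. Qed.

End hat.

#[global] Hint Extern 0 (measurable (oball _ _)) => solve [apply: measurable_oball] : core.
#[global] Hint Extern 0 (measurable_fun _ _) => solve [apply: measurable_Ehat] : core.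

Section mass.
Context {R : realType}.
Implicit Types (x h y : R) (A : set R).
Variable m : {measure set R -> \bar R}.
Hypothesis rad : radon m.

Definition mass A x h : R := fine (\int[m]_(y in A) (hat x h y)%:E)%E.

Lemma int_hat_le A x h : measurable A -> 0 < h ->
  (\int[m]_(y in A) (hat x h y)%:E <= m (oball x h `&` A))%E.
Proof.
move=> mA h0; rewrite -integral_indic//.
apply: ge0_le_integral => //.
- by move=> y _; rewrite lee_fin hat_ge0.
- by apply/measurable_EFinP; exact: measurable_indic.
- move=> y _; rewrite lee_fin indicE; have [yb|yb] := pselect (oball x h y).
    by rewrite mem_set// hat_le1.
  by rewrite hat_out.
Qed.

Lemma int_hat_fin A x h : measurable A -> 0 < h ->
  (\int[m]_(y in A) (hat x h y)%:E)%E \is a fin_num.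
Proof.
move=> mA h0; rewrite ge0_fin_numE; last first.
  by apply: integral_ge0 => y _; rewrite lee_fin hat_ge0.
apply: le_lt_trans (int_hat_le x mA h0) (le_lt_trans _ (rad x h)).
by apply: le_measure; rewrite ?inE//; exact: measurableI.
Qed.

Lemma massE A x h : measurable A -> 0 < h ->
  (mass A x h)%:E = (\int[m]_(y in A) (hat x h y)%:E)%E.
Proof. by move=> mA h0; rewrite fineK// int_hat_fin. Qed.

Lemma mass_ge0 A x h : 0 <= mass A x h.
Proof. by apply: fine_ge0; apply: integral_ge0 => y _; rewrite lee_fin hat_ge0. Qed.

Lemma mass_le A x h : measurable A -> 0 < h -> ((mass A x h)%:E <= m (oball x h `&` A))%E.
Proof. by move=> mA h0; rewrite massE// int_hat_le. Qed.

Lemma mass_ge A x h s : measurable A -> 0 < h -> s <= 1 ->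
  ((1 - s)%:E * m (oball x (s * h) `&` A) <= (mass A x h)%:E)%E.
Proof.
move=> mA h0 s1; rewrite massE// -integral_indic// -ge0_integralZl_EFin//.
- apply: ge0_le_integral => //.
  + by move=> y _; rewrite mule_ge0// lee_fin ?subr_ge0// indicE.
  + apply: measurable_funeM; apply/measurable_EFinP.
    exact: measurable_indic.
  + move=> y _; rewrite -EFinM lee_fin indicE.
    have [yb|yb] := pselect (oball x (s * h) y).
      by rewrite mem_set// mulr1 hat_ge.
    by rewrite memNset// mulr0 hat_ge0.
- by apply/measurable_EFinP; exact: measurable_indic.
- by rewrite subr_ge0.
Qed.

Lemma le_mass A B x h : measurable A -> measurable B -> 0 < h -> A `<=` B ->
  mass A x h <= mass B x h.
Proof.
move=> mA mB h0 AB; rewrite -lee_fin !massE//.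
apply: ge0_subset_integral => //.
by move=> y _; rewrite lee_fin hat_ge0.
Qed.

Lemma mass_refine A x h : measurable A -> 0 < h -> refine (mass A) x h = mass A x h.
Proof.
move=> mA h0; have h20 : 0 < h / 2 by rewrite divr_gt0.
apply: EFin_inj; rewrite massE// /refine -sumEFin.
rewrite (eq_bigr (fun i => \int[m]_(y in A) ((wt i)%:E * (hat (child x h i) (h / 2) y)%:E))%E); last first.
  move=> i _; rewrite ge0_integralZl_EFin ?wt_ge0//; first by rewrite EFinM massE.
  by move=> y _; rewrite lee_fin hat_ge0.
rewrite -ge0_integral_sum//; last 2 first.
- by move=> i; apply: measurable_funeM.
- by move=> i y _; rewrite mule_ge0 ?lee_fin ?wt_ge0 ?hat_ge0.
apply: eq_integral => y _; rewrite -(hat_refine x y h0) -sumEFin.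
by apply: eq_bigr.
Qed.

End mass.

(** * Doubling measures *)

Section doubling_lemmas.
Context {R : realType}.
Implicit Types (x h y r s : R) (A : set R) (m : {measure set R -> \bar R}).

Definition doubling_with m (D : R) : Prop :=
  forall x r, 0 < r -> (m (oball x (2 * r)) <= D%:E * m (oball x r))%E.

Lemma doubling_withW m D D' : D <= D' -> doubling_with m D -> doubling_with m D'.
Proof.
move=> DD' dm x r r0; apply: le_trans (dm x r r0) _.
by rewrite lee_wpmul2r ?lee_fin// measure_ge0.
Qed.

Lemma sub_oball x y r s : `|x - y| + r <= s -> oball x r `<=` oball y s.
Proof.
by move=> h z; rewrite !oballE => zx; have := ler_distD x z y; lra.
Qed.

Lemma le_measure_oball m x y r s : `|x - y| + r <= s -> (m (oball x r) <= m (oball y s))%E.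
Proof. by move=> h; apply: le_measure; rewrite ?inE//; exact: sub_oball. Qed.

Variables (m : {measure set R -> \bar R}) (D : R).
Hypotheses (rad : radon m) (D1 : 1 <= D) (dm : doubling_with m D).

Lemma doubling_exp k x r : 0 < r ->
  (m (oball x (2 ^+ k * r)) <= (D ^+ k)%:E * m (oball x r))%E.
Proof.
move=> r0; elim: k => [|k IH]; first by rewrite !expr0 mul1r mul1e.
rewrite exprS -mulrA; apply: le_trans (dm _ _) _; first by rewrite mulr_gt0// exprn_gt0.
by rewrite exprS EFinM -muleA lee_wpmul2l// lee_fin (le_trans ler01).
Qed.

Lemma doubling_oball k x y r s : 0 < s -> `|x - y| + r <= 2 ^+ k * s ->
  (m (oball x r) <= (D ^+ k)%:E * m (oball y s))%E.
Proof.
by move=> s0 h; apply: le_trans (doubling_exp k y s0); exact: le_measure_oball.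
Qed.

(** If one ball were null, so would be its dilates by 2^n, and they exhaust the line. *)
Lemma doubling_gt0 x r : m setT != 0%E -> 0 < r -> (0 < m (oball x r))%E.
Proof.
move=> mT r0; rewrite lt_neqAle measure_ge0 andbT eq_sym.
apply/negP => /eqP m0; move/negP: mT; apply.
rewrite -measure_le0.
apply: (@le_trans _ _ (\sum_(n <oo) m (oball x (2 ^+ n * r)))%E).
  apply: measure_sigma_subadditive => // y _.
  pose n := Num.trunc (`|y - x| / r); exists n => //; rewrite oballE.
  rewrite -ltr_pdivrMr//; apply: (lt_le_trans (truncnS_gt _)).
  by rewrite -/n -natrX ler_nat ltn_expl.
rewrite eseries0// => n _ _; apply/eqP; rewrite -measure_le0.
by apply: le_trans (doubling_exp n x r0) _; rewrite m0 mule0.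
Qed.

Lemma measure_oball_fin x r : m (oball x r) \is a fin_num.
Proof. by rewrite ge0_fin_numE ?rad. Qed.

(** The tent is at least 1/2 on the ball of half its width, whence the factor 2; k doublings of that
    ball reach the given one. *)
Lemma oball_le_mass k x h y s : 0 < h -> `|y - x| + s <= 2 ^+ k * (h / 2) ->
  (m (oball y s) <= (2 * D ^+ k * mass m setT x h)%:E)%E.
Proof.
move=> h0 ys; have h20 : 0 < h / 2 by rewrite divr_gt0.
apply: le_trans (doubling_oball h20 ys) _.
have hh : 2^-1 <= 1 :> R by lra.
have := @mass_ge _ m rad setT x h 2^-1 measurableT h0 hh.
rewrite setIT mulrC -(fineK (measure_oball_fin _ _)) -!EFinM !lee_fin => H.
have Dk : 0 <= D ^+ k by rewrite exprn_ge0// (le_trans ler01).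
by rewrite [2 * _]mulrC -mulrA; apply: ler_wpM2l => //; lra.
Qed.

Lemma mass_gt0 x h : m setT != 0%E -> 0 < h -> 0 < mass m setT x h.
Proof.
move=> mT h0; have h20 : 0 < h / 2 by rewrite divr_gt0.
have := @oball_le_mass 0 x h x (h / 2) h0.
rewrite subrr normr0 add0r expr0 mul1r lexx => /(_ isT).
move=> /(lt_le_trans (doubling_gt0 x mT h20)).
by rewrite lte_fin mulr1 pmulr_rgt0.
Qed.

Lemma child_dist x h i : 0 < h -> `|x - child x h i| <= h / 2.
Proof.
move=> h0; have h20 : 0 < h / 2 by rewrite divr_gt0.
rewrite /child opprD addrA subrr add0r normrN normrM (gtr0_norm h20).
rewrite ger_pMl//.
have : (i%:R : R) <= 2 by rewrite (ler_nat _ _ 2) -ltnS ltn_ord.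
by have := ler0n R i; rewrite ler_norml; lra.
Qed.

(** One factor 2 in the constant is a weight 1/2 and the other is [oball_le_mass]; three doublings
    of the ball of radius h/4 about a child cover the parent's ball, as h/2 + h <= 2 h. *)
Lemma mass_refining : m setT != 0%E -> refining (mass m setT) (4 * D ^+ 3)^-1.
Proof.
move=> mT x h h0; have h20 : 0 < h / 2 by rewrite divr_gt0.
have M0 := mass_gt0 x mT h0.
have D0 : 0 < D by exact: lt_le_trans D1.
split=> [//||i]; first exact: mass_refine.
rewrite /transition ler_pdivlMr//.
have w2 : 2^-1 <= wt i :> R by rewrite /wt; case: ifP => // _; lra.
apply: (@le_trans _ _ (2^-1 * mass m setT (child x h i) (h / 2))); last first.
  by rewrite ler_wpM2r// mass_ge0.
rewrite mulrC ler_pdivrMr ?mulr_gt0//.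
have -> : 2^-1 * mass m setT (child x h i) (h / 2) * (4 * D ^+ 3) =
  2 * D ^+ 3 * mass m setT (child x h i) (h / 2) by field.
rewrite -lee_fin; apply: le_trans (mass_le rad _ _ _) _ => //; rewrite setIT.
apply: oball_le_mass => //.
have := child_dist x i h0; lra.
Qed.

End doubling_lemmas.

(** * Comparison with alpha *)

Section alpha_lower_bound.
Context {R : realType}.
Implicit Types (x h y t a b : R) (m mu nu : {measure set R -> \bar R}).

Lemma measurable_TI a b : measurable_fun setT (TI a b).
Proof.
apply: measurable_funM; last exact: measurable_cst.
by apply: measurable_funB; [exact: measurable_id|exact: measurable_cst].
Qed.

(** [normpush] is a bare set function; it is recognised as a scaled pushforward of a restricted
    measure so that the integration lemmas apply. As psi composed with T_I vanishes off the
    interval, the restriction can then be dropped. *)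
Lemma integral_normpush m a b (psi : R -> R) : (forall u, 0 <= psi u) ->
  measurable_fun setT psi -> (forall y, ~ `]a, b[%classic y -> psi (TI a b y) = 0) ->
  (\int[normpush m a b]_u (psi u)%:E =
   ((fine (m `]a, b[%classic))^-1)%:E * \int[m]_y (psi (TI a b y))%:E)%E.
Proof.
move=> psi0 mpsi psiI.
have mI : measurable (`]a, b[%classic : set R) by exact: measurable_itv.
have k0 : 0 <= (fine (m `]a, b[%classic))^-1 by rewrite invr_ge0 fine_ge0.
pose mr : {measure set R -> \bar R} := mrestr m mI.
pose mp0 := (pushforward mr (TI a b) : {measure set R -> \bar R}).
pose mp : {measure set R -> \bar R} := mp0 (measurable_TI a b).
pose mm : {measure set R -> \bar R} := mscale (NngNum k0) mp.
rewrite (_ : normpush m a b = mm)//.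
rewrite ge0_integral_mscale//=; last 2 first.
- by apply/measurable_EFinP.
- by move=> u _; rewrite lee_fin.
congr (_ * _)%E.
rewrite ge0_integral_pushforward//=; last 3 first.
- exact: measurable_TI.
- by apply/measurable_EFinP.
- by move=> u _; rewrite lee_fin.
have E (m' : {measure set R -> \bar R}) : (\int[m']_y (psi (TI a b y))%:E =
    \int[m']_(y in `]a, b[%classic) (psi (TI a b y))%:E)%E.
  rewrite [RHS]integral_mkcond; apply: eq_integral => y _; rewrite patchE.
  by case: ifPn => // /negP; rewrite inE => /psiI ->.
rewrite preimage_setT E [RHS]E; apply: eq_measure_integral => A mA AI.
by rewrite /mr /= /mrestr; congr (m _); apply/setIidPl.
Qed.

Lemma oball_TI y t z : 0 < t -> y - t + 2 * t * TI (y - t) (y + t) z = z.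
Proof.
move=> t0; rewrite /TI (_ : y + t - (y - t) = 2 * t); last by ring.
by rewrite mulrC divfK ?subrKC// gt_eqF// mulr_gt0.
Qed.

(** Transported to [0,1], the tent has Lipschitz constant 2t/h; multiplied by h/(2t) it becomes an
    admissible test function, supported in [0,1] because its ball lies in the interval. *)
Lemma alpha_ge_hat mu nu x h y t : radon mu -> radon nu -> 0 < h -> 0 < t ->
  oball x h `<=` oball y t ->
  ((h / (2 * t) * `|mass mu setT x h / fine (mu (oball y t)) -
                    mass nu setT x h / fine (nu (oball y t))|)%:E
     <= alpha mu nu (y - t) (y + t))%E.
Proof.
move=> rmu rnu h0 t0 sub.
have ht : 0 < h / (2 * t) by rewrite divr_gt0// mulr_gt0.
pose psi u := h / (2 * t) * hat x h (y - t + 2 * t * u).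
have psi0 u : 0 <= psi u by rewrite mulr_ge0 ?(ltW ht) ?hat_ge0.
have mpsi : measurable_fun setT psi.
  apply: measurable_funM; first exact: measurable_cst.
  apply: (@measurableT_comp _ _ _ _ _ _ (hat x h)); first exact: measurable_hat.
  apply: measurable_funD; first exact: measurable_cst.
  by apply: measurable_funM; [exact: measurable_cst|exact: measurable_id].
have psiT z : psi (TI (y - t) (y + t) z) = h / (2 * t) * hat x h z.
  by rewrite /psi oball_TI.
have lip : lip1_01 psi.
  split=> [u v|u].
    rewrite /psi -mulrBr normrM (gtr0_norm ht).
    apply: le_trans (ler_wpM2l (ltW ht) (hat_lip x _ _ h0)) _.
    rewrite (_ : _ - _ = 2 * t * (u - v)); last by ring.
    rewrite normrM (@gtr0_norm _ (2 * t)) ?mulr_gt0//.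
    by rewrite le_eqVlt; apply/orP; left; apply/eqP; field; rewrite !gt_eqF.
  move=> uI; rewrite /psi hat_out ?mulr0// => /sub.
  rewrite /oball /= in_itv /= => /andP[u0 u1]; apply: uI; rewrite /= in_itv /=.
  have : 0 < t * u by lra.
  have : t * u < t * 1 by lra.
  by rewrite ltr_pM2l// pmulr_rgt0// => ? ?; apply/andP; split; exact: ltW.
have E m : radon m -> (\int[normpush m (y - t) (y + t)]_u (psi u)%:E =
    (h / (2 * t) * (mass m setT x h / fine (m (oball y t))))%:E)%E.
  move=> rm; rewrite integral_normpush//; last first.
    by move=> z zI; rewrite psiT hat_out ?mulr0// => /sub.
  under eq_integral do rewrite psiT EFinM.
  rewrite ge0_integralZl_EFin//; last exact: ltW.
    by rewrite -massE// -!EFinM -/(oball y t); congr EFin; rewrite mulrC mulrA.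
  by move=> z _; rewrite lee_fin hat_ge0.
apply: ereal_sup_ubound; exists psi => //.
by rewrite !E// -EFinB -mulrBr abse_EFin normrM (gtr0_norm ht).
Qed.

Variables (mu nu : {measure set R -> \bar R}) (D : R).
Hypotheses (rmu : radon mu) (rnu : radon nu) (D1 : 1 <= D).
Hypotheses (dmu : doubling_with mu D) (dnu : doubling_with nu D).
Hypotheses (mu0 : mu setT != 0%E) (nu0 : nu setT != 0%E).

Let M := mass mu setT.
Let N := mass nu setT.
Let c := (4 * D ^+ 3)^-1.

(** The factor c^-1 comes from dividing by the transition probabilities and 3 counts the children.
    Each difference of probabilities is at most 2 D^4 (8 + 16) alpha. *)
Definition alpha_const : R := c^-1 * 3 * (48 * D ^+ 4) ^+ 2.

(** The node and its children all lie in the single interval B(y,t), so one value of alpha compares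
    all their normalised masses. From t < 4h come h/(2t) >= 1/8 for the node and 1/16 for the
    children. *)
Lemma chi2_le_alpha x h y t : 0 < h -> `|y - x| < h / 4 -> 2 * h <= t -> t < 4 * h ->
  ((chi2 M N x h)%:E <= alpha_const%:E * alpha mu nu (y - t) (y + t) ^+ 2)%E.
Proof.
move=> h0 yx ht th.
have h20 : 0 < h / 2 by rewrite divr_gt0.
have t0 : 0 < t by lra.
have D0 : 0 < D by exact: lt_le_trans D1.
have c0 : 0 < c by rewrite invr_gt0 mulr_gt0// exprn_gt0.
have C0 : 0 < alpha_const.
  apply: mulr_gt0; last by apply: exprn_gt0; apply: mulr_gt0 => //; exact: exprn_gt0.
  by apply: mulr_gt0 => //; rewrite invr_gt0.
have xy : `|x - y| < h / 4 by rewrite distrC.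
have subp : oball x h `<=` oball y t by apply: sub_oball; lra.
have subc i : oball (child x h i) (h / 2) `<=` oball y t.
  apply: subset_trans subp; apply: sub_oball.
  by have := child_dist x i h0; rewrite distrC; lra.
have := alpha_ge_hat rmu rnu h0 t0 subp.
have hc i := alpha_ge_hat rmu rnu h20 t0 (subc i).
move: hc; case: (alpha mu nu (y - t) (y + t)) => [al| |].
- move=> hc; rewrite lee_fin => hp; rewrite -EFin_expe -EFinM lee_fin.
  have fm y' s : mu (oball y' s) = (fine (mu (oball y' s)))%:E by rewrite fineK// measure_oball_fin.
  have fn y' s : nu (oball y' s) = (fine (nu (oball y' s)))%:E by rewrite fineK// measure_oball_fin.
  have := doubling_gt0 D1 dmu y mu0 t0; rewrite fm lte_fin.
  have := doubling_gt0 D1 dnu y nu0 t0; rewrite fn lte_fin.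
  have := @oball_le_mass _ mu D rmu D1 dmu 4 x h y t h0; rewrite fm lee_fin => /(_ _)BM.
  have {}BM : fine (mu (oball y t)) <= 2 * D ^+ 4 * mass mu [set: R] x h.
    apply: BM; rewrite (_ : 2 ^+ 4 * (h / 2) = 8 * h); last by field.
    lra.
  move: hc hp BM.
  set Bm := fine (mu (oball y t)); set Bn := fine (nu (oball y t)).
  move=> hc hp BM Bn0 Bm0.
  have M0 : 0 < M x h by exact: mass_gt0 dmu _ _ _ _.
  have N0 : 0 < N x h by exact: mass_gt0 dnu _ _ _ _.
  have rM : refining M c by exact: mass_refining.
  have rN : refining N c by exact: mass_refining.
  apply: le_trans (chi2_le_diff N rM c0 x h0) _.
  have -> : alpha_const * al ^+ 2 = c^-1 * \sum_(i < 3) (48 * (D ^+ 4 * al)) ^+ 2.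
    by rewrite sumr_const card_ord /alpha_const; ring.
  apply: ler_wpM2l; first by rewrite invr_ge0 ltW.
  apply: ler_sum => i _.
  have al0 : 0 <= al by apply: le_trans hp; rewrite mulr_ge0// ltW// divr_gt0// mulr_gt0.
  have D40 : 0 < D ^+ 4 by rewrite exprn_gt0.
  rewrite -[leLHS]real_normK ?num_real// ler_sqr ?nnegrE//; last by apply: mulr_ge0 => //; apply: mulr_ge0 => //; exact: ltW.
  have w1 := @wt_le1 R i; have w0 := @wt_ge0 R i.
  have p1 := refining_le1 c0 x i rN h0.
  have p0 : 0 <= transition N x h i.
    by have [_ _ cN] := rN x h h0; exact: le_trans (ltW c0) (cN i).
  (* The two nu-terms on the right cancel, because the transition probability times N is the
     weighted mass of the child; only differences controlled by alpha remain. *)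
  have -> : transition N x h i - transition M x h i =
    Bm / M x h * (transition N x h i * (M x h / Bm - N x h / Bn) -
      wt i * (M (child x h i) (h / 2) / Bm - N (child x h i) (h / 2) / Bn)).
    by rewrite /transition; field; rewrite !gt_eqF.
  have {}hp : `|M x h / Bm - N x h / Bn| <= 8 * al.
    have : 1 / 8 * `|M x h / Bm - N x h / Bn| <= h / (2 * t) * `|M x h / Bm - N x h / Bn|.
      by rewrite ler_wpM2r// ler_pdivlMr ?mulr_gt0//; lra.
    move: hp; rewrite -/M -/N; lra.
  have {}hc : `|M (child x h i) (h / 2) / Bm - N (child x h i) (h / 2) / Bn| <= 16 * al.
    have : 1 / 16 * `|M (child x h i) (h / 2) / Bm - N (child x h i) (h / 2) / Bn| <=
       h / 2 / (2 * t) * `|M (child x h i) (h / 2) / Bm - N (child x h i) (h / 2) / Bn|.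
      by rewrite ler_wpM2r// ler_pdivlMr ?mulr_gt0//; lra.
    have := hc i; rewrite lee_fin -/M -/N -/Bm -/Bn; lra.
  rewrite normrM (@gtr0_norm _ (Bm / M x h)) ?divr_gt0//.
  have hB : Bm / M x h <= 2 * D ^+ 4 by rewrite ler_pdivrMr.
  have hs (T w u v : R) : 0 <= T -> T <= 1 -> 0 <= w -> w <= 1 ->
      `|u| <= 8 * al -> `|v| <= 16 * al -> `|T * u - w * v| <= 24 * al.
    move=> T0 T1 W0 W1 hu hv.
    apply: le_trans (ler_normB _ _) _; rewrite !normrM (ger0_norm T0) (ger0_norm W0).
    have h1 := ler_pM T0 (normr_ge0 _) T1 hu.
    have h2 := ler_pM W0 (normr_ge0 _) W1 hv.
    by move: h1 h2; rewrite !mul1r; lra.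
  have {}hs := hs _ _ _ _ p0 p1 w0 w1 hp hc.
  have := ler_pM (ltW (divr_gt0 Bm0 M0)) (normr_ge0 _) hB hs.
  by move=> /le_trans; apply; rewrite le_eqVlt; apply/orP; left; apply/eqP; ring.
- by move=> _ _; rewrite expe2 mulyy gt0_muley ?leey ?lte_fin.
- by move=> _; rewrite leeNy_eq.
Qed.

End alpha_lower_bound.

(** * The Carleson condition *)

Section lower_integral.
Local Open Scope ereal_scope.
Context d (T : measurableType d) (R : realType).
Variable m : {measure set T -> \bar R}.

(* Needed because [alpha] is a supremum of uncountably many functions of the interval;
   it holds since the integral of a nonnegative function is a supremum over simple functions. *)
Lemma ge0_le_integral_nonmeas (A : set T) (f g : T -> \bar R) :
  (forall x, A x -> 0 <= f x) -> (forall x, A x -> f x <= g x) ->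
  \int[m]_(x in A) f x <= \int[m]_(x in A) g x.
Proof.
move=> f0 fg; rewrite !ge0_integralE//; last first.
  by move=> x Ax; exact: le_trans (f0 x Ax) (fg x Ax).
apply: le_ereal_sup => _ [h hf <-]; exists h => // x.
apply: le_trans (hf x) _; rewrite !patchE; case: ifPn => //.
by rewrite inE => /fg.
Qed.

End lower_integral.

Section ball_sup.
Context {R : realType}.
Implicit Types (x y r : R) (F : R -> R).

Lemma oball_ball x r : oball x r = ball x r.
Proof. by rewrite ball_itv. Qed.

Lemma open_oball x r : open (oball x r).
Proof. by rewrite oball_ball; exact: ball_open. Qed.

Definition ball_sup F r y : \bar R := ereal_sup [set (F x)%:E | x in oball y r].

Lemma ball_sup_ge F r x y : oball x r y -> ((F x)%:E <= ball_sup F r y)%E.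
Proof.
move=> xy; apply: ereal_sup_ubound; exists x => //.
by move: xy; rewrite !oballE distrC.
Qed.

Lemma ball_sup_ge0 F r y : 0 < r -> 0 <= F y -> (0 <= ball_sup F r y)%E.
Proof.
move=> r0 F0; apply: (@le_trans _ _ (F y)%:E); first by rewrite lee_fin.
by apply: ball_sup_ge; rewrite oballE subrr normr0.
Qed.

(** Every superlevel set is a union of open balls of radius r, hence open, for an arbitrary function
    F. *)
Lemma measurable_ball_sup F r : measurable_fun setT (ball_sup F r).
Proof.
apply: lower_semicontinuous_measurable; apply/lower_semicontinuousP => a.
rewrite (_ : [set _ | _] = \bigcup_(x in [set x | a < F x]) oball x r).
  by apply: bigcup_open => x _; exact: open_oball.
apply/seteqP; split=> y /=.
  move=> /ereal_sup_gt[_ [x xy <-]]; rewrite lte_fin => aF; exists x => //.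
  by move: xy; rewrite !oballE distrC.
by move=> [x /= aF xy]; apply: lt_le_trans (ball_sup_ge F xy); rewrite lte_fin.
Qed.

End ball_sup.

Section carleson.
Context {R : realType}.
Implicit Types (x h y t : R).
Variables (mu nu : {measure set R -> \bar R}) (D C : R).
Hypotheses (rmu : radon mu) (rnu : radon nu) (D1 : 1 <= D).
Hypotheses (dmu : doubling_with mu D) (dnu : doubling_with nu D).
Hypotheses (mu0 : mu setT != 0%E) (nu0 : nu setT != 0%E).
Hypothesis (C0 : 0 <= C).
Hypothesis carl : forall x r : R, 0 < r ->
   (\int[mu]_(y in oball x (2 * r)%R)
      \int[lebesgue_measure]_(t in `]0%R, (2 * r)%R[%classic)
         ((alpha mu nu (y - t)%R (y + t)%R) ^+ 2 * (t^-1)%R%:E)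
    <= C%:E * mu (oball x r))%E.

Let M := mass mu setT.
Let N := mass nu setT.
Let c := (4 * D ^+ 3)^-1.
Let C1 := alpha_const D.

Let D0 : 0 < D. Proof. exact: lt_le_trans D1. Qed.
Let c0 : 0 < c. Proof. by rewrite invr_gt0 mulr_gt0// exprn_gt0. Qed.
Let rM : refining M c. Proof. exact: mass_refining. Qed.
Let rN : refining N c. Proof. exact: mass_refining. Qed.

Let C10 : 0 < C1.
Proof.
apply: mulr_gt0; last by apply: exprn_gt0; apply: mulr_gt0 => //; exact: exprn_gt0.
by apply: mulr_gt0 => //; rewrite invr_gt0.
Qed.

(* A measurable minorant, up to a constant, of [alpha^2] on the intervals centred at [y] of
   radius in [[2 h, 4 h)]. *)
Definition local_chi h y := ball_sup (fun x => chi2 M N x h) (h / 4) y.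

Lemma local_chi_ge0 h y : 0 < h -> (0 <= local_chi h y)%E.
Proof. by move=> h0; apply: ball_sup_ge0; [rewrite divr_gt0|exact: (chi2_ge0 N rM c0 y h0)]. Qed.

Lemma local_chi_le_alpha h y t : 2 * h <= t -> t < 4 * h ->
  (local_chi h y <= C1%:E * alpha mu nu (y - t) (y + t) ^+ 2)%E.
Proof.
move=> ht th; apply: ge_ereal_sup => _ [x xy <-]; move: xy; rewrite oballE distrC => xy.
by apply: chi2_le_alpha => //; lra.
Qed.

Fixpoint sum_chi k h y : \bar R :=
  if k is k'.+1 then (local_chi h y + sum_chi k' (h / 2) y)%E else 0%E.

Lemma sum_chi_ge0 k h y : 0 < h -> (0 <= sum_chi k h y)%E.
Proof.
elim: k h => [//|k IH] h h0 /=; rewrite adde_ge0 ?local_chi_ge0 ?IH//.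
by rewrite divr_gt0.
Qed.

Lemma measurable_sum_chi k h : measurable_fun setT (sum_chi k h).
Proof.
elim: k h => [|k IH] h /=; first exact: measurable_cst.
by apply: emeasurable_funD; [exact: measurable_ball_sup|exact: IH].
Qed.

Let measurable_hat_sum_chi k h x :
  measurable_fun setT (fun y => (hat x h y)%:E * sum_chi k h y)%E.
Proof. by apply: emeasurable_funM => //; exact: measurable_sum_chi. Qed.

(** On B(x, h/4) the function [local_chi] is at least the value at x and the tent is at least 3/4;
    two doublings bound M by the mass of that ball. *)
Lemma mass_chi2_le x h : 0 < h ->
  ((M x h * chi2 M N x h)%:E <=
   (2 * D ^+ 2)%:E * \int[mu]_y ((hat x h y)%:E * local_chi h y))%E.
Proof.
move=> h0; have a0 := chi2_ge0 N rM c0 x h0.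
set a := chi2 M N x h in a0 *.
have h40 : 0 < h / 4 by rewrite divr_gt0.
have D2 : 0 < D ^+ 2 by rewrite exprn_gt0.
have h1 : ((M x h)%:E * a%:E <= (D ^+ 2)%:E * (a%:E * mu (oball x (h / 4))))%E.
  rewrite [(_ * a%:E)%E]muleC muleCA lee_wpmul2l ?lee_fin//.
  apply: le_trans (mass_le rmu _ measurableT h0) _; rewrite setIT.
  apply: (doubling_oball D1 dmu h40); rewrite subrr normr0 add0r.
  by rewrite le_eqVlt; apply/orP; left; apply/eqP; field.
rewrite EFinM; apply: le_trans h1 _.
rewrite [2 * _]mulrC [in leRHS]EFinM -muleA lee_wpmul2l ?lee_fin ?(ltW D2)//.
rewrite -ge0_integralZl_EFin//; last 2 first.
- by move=> y _; rewrite mule_ge0 ?local_chi_ge0// lee_fin hat_ge0.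
- by apply: emeasurable_funM => //; exact: measurable_ball_sup.
rewrite -integral_cst//.
rewrite integral_mkcond; apply: ge0_le_integral_nonmeas => y _.
  by rewrite patchE; case: ifP => _; rewrite ?lee_fin.
rewrite patchE; case: ifPn => [|_]; last first.
  by rewrite mule_ge0 ?mule_ge0 ?local_chi_ge0// lee_fin hat_ge0.
rewrite inE => yx.
have hy : 1 <= 2 * hat x h y.
  have := @hat_ge R x h y 4^-1 h0; rewrite mulrC => /(_ yx); lra.
rewrite muleA -EFinM; apply: (le_trans (ball_sup_ge (fun x => chi2 M N x h) yx)).
rewrite -[leLHS]mul1e lee_wpmul2r ?lee_fin ?local_chi_ge0//.
Qed.

(** Once the divergences are functions of y, the tree collapses: by the two-scale identity the
    weighted tents of each generation add up to the tent at the root. *)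
Lemma cumul_le_integral k x h : 0 < h ->
  ((cumul M (chi2 M N) k x h)%:E <=
   (2 * D ^+ 2)%:E * \int[mu]_y ((hat x h y)%:E * sum_chi k h y))%E.
Proof.
have D2 : 0 <= 2 * D ^+ 2 by rewrite mulr_ge0// exprn_ge0// ltW.
elim: k x h => [|k IH] x h h0 /=.
  by rewrite mule_ge0 ?lee_fin// integral_ge0// => y _; rewrite mule0.
have h20 : 0 < h / 2 by rewrite divr_gt0.
rewrite EFinD /refine -sumEFin.
have -> : (\int[mu]_y ((hat x h y)%:E * (local_chi h y + sum_chi k (h / 2) y)) =
  \int[mu]_y ((hat x h y)%:E * local_chi h y) +
  \int[mu]_y ((hat x h y)%:E * sum_chi k (h / 2) y))%E.
  rewrite -ge0_integralD//.
  - by apply: eq_integral => y _; rewrite ge0_muleDr ?local_chi_ge0 ?sum_chi_ge0.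
  - by move=> y _; rewrite mule_ge0 ?local_chi_ge0// lee_fin hat_ge0.
  - by apply: emeasurable_funM => //; exact: measurable_ball_sup.
  - by move=> y _; rewrite mule_ge0 ?sum_chi_ge0// lee_fin hat_ge0.
  - by apply: emeasurable_funM => //; exact: measurable_sum_chi.
rewrite ge0_muleDr; last 2 first.
- by apply: integral_ge0 => y _; rewrite mule_ge0 ?local_chi_ge0// lee_fin hat_ge0.
- by apply: integral_ge0 => y _; rewrite mule_ge0 ?sum_chi_ge0// lee_fin hat_ge0.
apply: leeD; first exact: mass_chi2_le.
have -> : (\int[mu]_y ((hat x h y)%:E * sum_chi k (h / 2) y) =
  \sum_(i < 3) (wt i)%:E * \int[mu]_y ((hat (child x h i) (h / 2) y)%:E * sum_chi k (h / 2) y))%E.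
  rewrite (eq_bigr (fun i => \int[mu]_y ((wt i)%:E * ((hat (child x h i) (h / 2) y)%:E * sum_chi k (h / 2) y)))%E); last first.
    move=> i _; rewrite ge0_integralZl_EFin ?wt_ge0//.
    by move=> y _; rewrite mule_ge0 ?sum_chi_ge0// lee_fin hat_ge0.
  rewrite -ge0_integral_sum//; last 2 first.
  - by move=> i; exact: measurable_funeM.
  - by move=> i y _; rewrite !mule_ge0 ?sum_chi_ge0// lee_fin ?hat_ge0 ?wt_ge0.
  apply: eq_integral => y _; rewrite -(hat_refine x y h0) -sumEFin ge0_sume_distrl.
    by apply: eq_bigr => i _; rewrite EFinM muleA.
  by move=> i _; rewrite lee_fin mulr_ge0 ?hat_ge0 ?wt_ge0.
rewrite ge0_sume_distrr; last first.
  move=> i _; rewrite mule_ge0 ?lee_fin ?wt_ge0// integral_ge0// => y _.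
  by rewrite mule_ge0 ?sum_chi_ge0// lee_fin hat_ge0.
apply: lee_sum => i _; rewrite EFinM muleCA lee_wpmul2l ?lee_fin ?wt_ge0//.
exact: IH.
Qed.

(* A step function of [t] lying below [alpha^2 / t] up to a constant: the dyadic intervals
   [[2 h / 2^j, 4 h / 2^j)] are disjoint. *)
Fixpoint step_chi k h y t : \bar R :=
  if k is k'.+1 then
    ((4 * h)^-1%:E * local_chi h y * (\1_(`[2 * h, 4 * h[%classic) t)%:E + step_chi k' (h / 2) y t)%E
  else 0%E.

Lemma step_chi_ge0 k h y t : 0 < h -> (0 <= step_chi k h y t)%E.
Proof.
elim: k h => [//|k IH] h h0 /=; rewrite adde_ge0 ?IH ?divr_gt0//.
by rewrite !mule_ge0 ?local_chi_ge0// lee_fin ?indicE// invr_ge0 mulr_ge0// ltW.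
Qed.

Lemma measurable_step_chi k h y : measurable_fun setT (step_chi k h y).
Proof.
elim: k h => [|k IH] h /=; first exact: measurable_cst.
apply: emeasurable_funD; last exact: IH.
by apply: measurable_funeM; apply/measurable_EFinP; exact: measurable_indic.
Qed.

(** Each scale contributes the length 2h of [2h, 4h) times 1/(4h), that is 1/2. *)
Lemma integral_step_chi k h y : 0 < h ->
  (\int[lebesgue_measure]_t step_chi k h y t = (2^-1)%:E * sum_chi k h y)%E.
Proof.
elim: k h => [|k IH] h h0 /=; first by rewrite integral0 mule0.
have h20 : 0 < h / 2 by rewrite divr_gt0.
have g0 : (0 <= (4 * h)^-1%:E * local_chi h y)%E.
  by rewrite mule_ge0 ?local_chi_ge0// lee_fin invr_ge0 mulr_ge0// ltW.
have m1 : measurable_fun setT (fun t : R => (\1_(`[2 * h, 4 * h[%classic) t)%:E : \bar R).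
  by apply/measurable_EFinP; exact: measurable_indic.
rewrite ge0_integralD//; last 4 first.
- by move=> t _; rewrite mule_ge0// lee_fin indicE.
- exact: measurable_funeM.
- by move=> t _; exact: step_chi_ge0.
- exact: measurable_step_chi.
rewrite IH// ge0_integralZl//.
rewrite integral_indic// setIT/= lebesgue_measure_itv/= lte_fin.
rewrite ltr_pM2r// ltr_nat /= -EFinD.
rewrite [RHS]ge0_muleDr ?local_chi_ge0 ?sum_chi_ge0// muleAC -EFinM.
by congr (_%:E * _ + _)%E; field; rewrite gt_eqF.
Qed.

(** The second clause carries the induction: for t in [2h, 4h) all smaller scales vanish, so a
    single term is compared with alpha^2, using 1/(4h) <= 1/t. *)
Lemma step_chi_le_alpha k h y t : 0 < h -> 0 < t ->
  (step_chi k h y t <= C1%:E * (alpha mu nu (y - t) (y + t) ^+ 2 * (t^-1)%:E))%E /\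
  (4 * h <= t -> step_chi k h y t = 0%E).
Proof.
move=> + t0; elim: k h => [|k IH] h h0 /=.
  split=> //; apply: mule_ge0; first by rewrite lee_fin ltW.
  by apply: mule_ge0; [exact: sqre_ge0|rewrite lee_fin invr_ge0 ltW].
have h20 : 0 < h / 2 by rewrite divr_gt0.
have [IH1 IH2] := IH _ h20; split; last first.
  move=> ht; rewrite IH2; last by lra.
  by rewrite indicE memNset ?mule0 ?adde0//= in_itv/= => /andP[_]; rewrite ltNge ht.
rewrite indicE; have [|tI] := boolP (t \in _); last by rewrite mule0 add0e.
rewrite inE /= in_itv/= => /andP[t1 t2].
rewrite IH2; last by lra.
rewrite mule1 adde0 muleA muleC.
apply: lee_pmul; [exact: local_chi_ge0|by rewrite lee_fin invr_ge0 mulr_ge0// ltW| |].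
  exact: local_chi_le_alpha.
by rewrite lee_fin lef_pV2 ?posrE ?mulr_gt0// ltW.
Qed.

(** In order: the factor of [cumul_le_integral]; 2 for the half in [integral_step_chi]; the constant
    of [chi2_le_alpha]; the hypothesis at radius r = 2h; and the bound of mu(B(x,2h)) by 2 D^2 M. *)
Definition carleson_const := 2 * D ^+ 2 * (2 * C1 * (C * (2 * D ^+ 2))).

Lemma cumul_chi2_le k x h : 0 < h ->
  cumul M (chi2 M N) k x h <= carleson_const * M x h.
Proof.
move=> h0; rewrite -lee_fin; apply: le_trans (cumul_le_integral k x h0) _.
have D2 : 0 < 2 * D ^+ 2 by rewrite mulr_gt0// exprn_gt0.
rewrite /carleson_const -mulrA [in leRHS]EFinM lee_wpmul2l ?lee_fin ?(ltW D2)//.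
have h20 : 0 < 2 * h by rewrite mulr_gt0.
have := carl x h20; rewrite (_ : 2 * (2 * h) = 4 * h); last by ring.
have := @oball_le_mass _ mu D rmu D1 dmu 2 x h x (2 * h) h0.
rewrite subrr normr0 add0r (_ : 2 ^+ 2 * (h / 2) = 2 * h) ?lexx; last by field.
move=> /(_ isT) hm hc.
suff : ((2 * C1)^-1%:E * \int[mu]_y ((hat x h y)%:E * sum_chi k h y) <=
  \int[mu]_(y in oball x (4 * h)) \int[lebesgue_measure]_(t in `]0%R, (4 * h)%R[%classic)
    (alpha mu nu (y - t) (y + t) ^+ 2 * (t^-1)%:E))%E.
  move=> H; have {}H := le_trans H hc.
  have C10' : 0 <= 2 * C1 by rewrite mulr_ge0// ltW.
  rewrite -[leLHS]mul1e -[X in (X%:E * _)%E](@mulfV _ (2 * C1)); last by rewrite gt_eqF// mulr_gt0.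
  have -> : 2 * C1 * (C * (2 * D ^+ 2)) * M x h = 2 * C1 * (C * (2 * D ^+ 2 * M x h)).
    by rewrite -!mulrA.
  rewrite EFinM -muleA [in leRHS]EFinM; apply: lee_wpmul2l; first by rewrite lee_fin.
  by apply: le_trans H _; rewrite [in leRHS]EFinM; apply: lee_wpmul2l; rewrite ?lee_fin.
have C12 : 0 < (2 * C1)^-1 by rewrite invr_gt0 mulr_gt0.
rewrite -ge0_integralZl_EFin ?(ltW C12)//; last first.
  by move=> y _; rewrite mule_ge0 ?sum_chi_ge0// lee_fin hat_ge0.
rewrite [leRHS]integral_mkcond; apply: ge0_le_integral_nonmeas => y _.
  by rewrite mule_ge0 ?mule_ge0 ?sum_chi_ge0 ?lee_fin ?hat_ge0// ltW.
rewrite patchE; case: ifPn => [_|]; last first.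
  move=> /negP; rewrite inE => yx; rewrite hat_out ?mul0e ?mule0//.
  by move=> yx'; apply: yx; apply: sub_oball yx'; rewrite subrr normr0; lra.
apply: (@le_trans _ _ ((2 * C1)^-1%:E * sum_chi k h y))%E.
  rewrite lee_wpmul2l ?lee_fin ?(ltW C12)// -[leRHS]mul1e lee_wpmul2r ?sum_chi_ge0//.
  by rewrite lee_fin hat_le1.
have -> : ((2 * C1)^-1%:E * sum_chi k h y =
    \int[lebesgue_measure]_t (C1^-1%:E * step_chi k h y t))%E.
  rewrite ge0_integralZl_EFin ?invr_ge0 ?(ltW C10)//; last 2 first.
  - by move=> t _; exact: step_chi_ge0.
  - exact: measurable_step_chi.
  by rewrite integral_step_chi// muleA -EFinM invfM mulrC.
rewrite [leRHS]integral_mkcond; apply: ge0_le_integral_nonmeas => t _.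
  by rewrite mule_ge0 ?step_chi_ge0// lee_fin invr_ge0 ltW.
rewrite patchE; case: ifPn => [|/negP]; rewrite inE /= in_itv /=.
  move=> /andP[t0 th]; have [st _] := step_chi_le_alpha k y h0 t0.
  by rewrite lee_pdivrMl.
move=> tI; have [t0|t0] := leP t 0; last first.
  have [_ ->] := step_chi_le_alpha k y h0 t0; first by rewrite mule0.
  by rewrite leNgt; apply/negP => th; apply: tI; rewrite t0.
suff -> : step_chi k h y t = 0%E by rewrite mule0.
elim: k h h0 {tI hm hc h20 C12} => [//|k IH] h h0 /=.
rewrite IH ?divr_gt0// adde0 indicE memNset ?mule0//= in_itv/= => /andP[+ _].
by rewrite leNgt (le_lt_trans t0)// mulr_gt0.
Qed.

End carleson.

(** * Open sets *)

Section inner_part.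
Context {R : realType}.
Implicit Types (x h e : R) (U A : set R).

(** The erosion of U by e. It is closed and, for open U, increases to U as e decreases to 0. *)
Definition inner_part e U : set R := [set y | oball y e `<=` U].

Lemma closed_inner_part e U : closed (inner_part e U).
Proof.
rewrite (_ : inner_part e U = ~` (\bigcup_(z in ~` U) oball z e)).
  by rewrite closedC; apply: bigcup_open => z _; exact: open_oball.
apply/seteqP; split=> y /=.
  by move=> yU [z zU zy]; apply: zU; apply: yU; move: zy; rewrite !oballE distrC.
move=> h z zy; apply: contrapT => zU; apply: h; exists z => //.
by move: zy; rewrite !oballE distrC.
Qed.

Lemma measurable_inner_part e U : measurable (inner_part e U).
Proof. by apply: closed_measurable; exact: closed_inner_part. Qed.

Lemma inner_part_sub e U : 0 < e -> inner_part e U `<=` U.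
Proof. by move=> e0 y; apply; rewrite oballE subrr normr0. Qed.

Lemma le_inner_part e e' U : e <= e' -> inner_part e' U `<=` inner_part e U.
Proof.
by move=> ee y yU; apply: subset_trans yU; apply: sub_oball; rewrite subrr normr0 add0r.
Qed.

Lemma inner_part_bigcup U (e : nat -> R) : open U -> (forall n, 0 < e n) ->
  (e n @[n --> \oo] --> 0) -> \bigcup_n inner_part (e n) U = U.
Proof.
move=> oU e0 elim0; apply/seteqP; split=> [y [n _]|y yU].
  exact: inner_part_sub.
have /nbhs_ballP[r /= r0 rU] : nbhs y U by rewrite nbhsE/=; exists U.
have [n _ nr] : \forall n \near \oo, e n < r by exact: (cvgr_lt 0 elim0 r r0).
by exists n => // z zn; apply: rU; rewrite -oball_ball; apply: sub_oball zn;
  rewrite subrr normr0 add0r ltW// nr /=.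
Qed.

End inner_part.

#[global] Hint Extern 0 (measurable (inner_part _ _)) => solve [apply: measurable_inner_part] : core.

Section leaves.
Context {R : realType}.
Implicit Types (x h : R) (U A : set R).
Variable m : {measure set R -> \bar R}.
Hypothesis rad : radon m.

Definition inside U x h : bool := `[< oball x h `<=` U >].

Lemma refine_iter_mass A k x h : measurable A -> 0 < h ->
  refine_iter (mass m A) k x h = mass m A x h.
Proof.
move=> mA; elim: k x h => [//|k IH] x h h0 /=.
rewrite -[RHS](mass_refine rad x mA h0).
by apply: eq_bigr => i _; rewrite IH// divr_gt0.
Qed.

Lemma leaves_le_mass U k x h : measurable U -> 0 < h ->
  refine_iter (fun y g => if inside U y g then mass m setT y g else 0) k x h <= mass m U x h.
Proof.
move=> mU h0; rewrite -[leRHS](refine_iter_mass k x mU h0).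
apply: ler_refine_iter => // y g g0; case: ifPn => [/asboolP yU|_]; last exact: mass_ge0.
rewrite -lee_fin !massE//; rewrite [leRHS]integral_mkcond.
apply: ge0_le_integral_nonmeas => z _; first by rewrite lee_fin hat_ge0.
rewrite patchE; case: ifPn => // /negP; rewrite inE => zU.
by rewrite hat_out// => /yU.
Qed.

(** If the ball of a leaf of width g is not inside U, then no y in it has B(y, 2g) inside U, so that
    leaf's tent vanishes on the eroded set. After k halvings g = h / 2^k. *)
Lemma mass_inner_le_leaves U k x h : 0 < h ->
  mass m (inner_part (2 * h / 2 ^+ k) U) x h <=
  refine_iter (fun y g => if inside U y g then mass m setT y g else 0) k x h.
Proof.
elim: k x h => [|k IH] x h h0 /=.
  rewrite expr0 divr1; case: ifPn => [_|/asboolPn xU]; first exact: le_mass.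
  rewrite /mass integral0_eq// => y yU; rewrite hat_out// => yx; apply: xU.
  apply: subset_trans yU; apply: sub_oball; move: yx; rewrite oballE distrC; lra.
have h20 : 0 < h / 2 by rewrite divr_gt0.
rewrite -[leLHS](mass_refine rad)//; apply: ler_refine => // y.
apply: le_trans (IH _ _ h20).
rewrite (_ : 2 * (h / 2) / 2 ^+ k = 2 * h / 2 ^+ k.+1)//.
by rewrite exprS; field; rewrite expf_neq0.
Qed.

Lemma mass_open_le U x h b : open U -> 0 < h ->
  (forall k, mass m (inner_part (2 * h / 2 ^+ k) U) x h <= b) -> mass m U x h <= b.
Proof.
move=> oU h0 H; have mU : measurable U by exact: open_measurable.
have e0 k : 0 < 2 * h / 2 ^+ k by rewrite divr_gt0 ?mulr_gt0 ?exprn_gt0.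
have e1 : (2 * h / 2 ^+ k) @[k --> \oo] --> (0 : R).
  have : geometric (2 * h) (2^-1) @ \oo --> 0.
    by apply: cvg_geometric; rewrite ger0_norm// invf_lt1// ltr1n.
  by apply: cvg_trans; apply: near_eq_cvg; near=> k; rewrite /geometric /= exprVn.
rewrite -lee_fin massE//; rewrite -{1}(inner_part_bigcup oU e0 e1).
have nd : nondecreasing_seq (fun k => inner_part (2 * h / 2 ^+ k) U).
  apply/nondecreasing_seqP => k; rewrite subsetEset; apply: le_inner_part.
  rewrite ler_pM2l ?mulr_gt0// lef_pV2 ?posrE ?exprn_gt0// exprS.
  by rewrite ler_peMl ?exprn_ge0// ler1n.
have cv := @ge0_nondecreasing_set_cvg_integral _ _ _ _ (fun y => (hat x h y)%:E) m nd
  (fun=> measurable_inner_part _ _) (fun=> @measurable_Ehat R _ x h)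
  (fun _ y _ => hat_ge0 x h y).
rewrite -(cvg_lim _ cv)//; apply: lime_le; first by apply/cvg_ex; eexists; exact: cv.
by apply: nearW => k; rewrite -massE// lee_fin.
Unshelve. all: by end_near. Qed.

End leaves.

(** * Borel sets *)

Section regularity.
Context {R : realType}.
Local Open Scope ereal_scope.
Variable m : {measure set R -> \bar R}.
Hypothesis mfin : m setT < +oo.

(** Two-sided approximation is symmetric under complements, so the sets that have it form a
    sigma-algebra; outer approximation alone would not be stable. *)
Definition squeezed (A : set R) : Prop := forall d : R, (0 < d)%R ->
  exists F U, [/\ closed F, open U, F `<=` A, A `<=` U & m (U `\` F) <= d%:E].

Lemma measure_small (S : (set R)^nat) : (forall n, measurable (S n)) ->
  nonincreasing_seq S -> \bigcap_n S n = set0 ->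
  forall d : R, (0 < d)%R -> exists n, m (S n) <= d%:E.
Proof.
move=> mS nS S0 d d0.
have : m (S n) @[n --> \oo] --> m (\bigcap_n S n).
  apply: nonincreasing_cvg_mu => //; last by rewrite S0.
  by apply: le_lt_trans mfin; apply: le_measure; rewrite ?inE.
rewrite S0 measure0 => /(_ [set y | y < d%:E]) /(_ (open_ereal_lt' _)).
rewrite lte_fin => /(_ d0)[n _ /(_ n (leqnn n))] /= Sn.
by exists n; exact: ltW.
Qed.

Lemma squeezed_setC A : squeezed A -> squeezed (setT `\` A).
Proof.
move=> sA d d0; have [F [U [cF oU FA AU UF]]] := sA d d0.
exists (~` U), (~` F); split.
- by rewrite closedC.
- exact: closed_openC.
- by move=> x xU; split => // /AU.
- by move=> x [_ xA] /FA.
- by rewrite (_ : _ `\` _ = U `\` F)// !setDE setCK setIC.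
Qed.

(** An infinite union of closed sets may fail to be closed, so it is cut to a finite one. Half of d
    goes to the gaps U_n minus F_n and half to the cut, which is small by continuity from above for
    a finite measure. *)
Lemma squeezed_bigcup (A : (set R)^nat) : (forall n, squeezed (A n)) -> squeezed (\bigcup_n A n).
Proof.
move=> sA d d0; have d20 : (0 < d / 2)%R by rewrite divr_gt0.
pose e n : R := (d / 2 / (2 ^ n.+1)%:R)%R.
have e0 n : (0 < e n)%R by rewrite divr_gt0// ltr0n expn_gt0.
have /choice[FU FUP] : forall n, exists FU : set R * set R,
    [/\ closed FU.1, open FU.2, FU.1 `<=` A n, A n `<=` FU.2 & m (FU.2 `\` FU.1) <= (e n)%:E].
  by move=> n; have [F [U H]] := sA n _ (e0 n); exists (F, U).
pose F n := (FU n).1; pose U n := (FU n).2.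
have cF n : closed (F n) by have [] := FUP n.
have oU n : open (U n) by have [] := FUP n.
have mF n : measurable (F n) by exact: closed_measurable.
have mU n : measurable (U n) by exact: open_measurable.
pose G n := \big[setU/set0]_(i < n) F i.
have mG n : measurable (G n) by exact: bigsetU_measurable.
have mFF : measurable (\bigcup_n F n) by exact: bigcup_measurable.
have mUU : measurable (\bigcup_n U n) by exact: bigcup_measurable.
have UF : m (\bigcup_n U n `\` \bigcup_n F n) <= (d / 2)%:E.
  apply: (@le_trans _ _ (\sum_(n <oo) m (U n `\` F n))).
    apply: measure_sigma_subadditive.
    - by move=> n; exact: measurableD.
    - exact: measurableD.
    - move=> x [[n _ xU] xF]; exists n => //; split => // xFn.
      by apply: xF; exists n.
  apply: (@le_trans _ _ (\sum_(n <oo) (e n)%:E)).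
    by apply: lee_nneseries => n _ //; have [] := FUP n.
  exact: epsilon_trick0 (ltW d20).
have [|||n Gn] := @measure_small (fun n => \bigcup_n F n `\` G n) _ _ _ (d / 2) d20.
- by move=> n; exact: measurableD.
- apply/nonincreasing_seqP => n; rewrite subsetEset; apply: setDS.
  by rewrite /G big_ord_recr /=; exact: subsetUl.
- apply/seteqP; split=> // x H; have [[n _ xF] _] := H 0%N I.
  have [_] := H n.+1 I; apply; rewrite /G -(bigcup_mkord n.+1 F).
  by exists n => //=.
exists (G n), (\bigcup_n U n); split.
- by rewrite /G -(bigcup_mkord n F); apply: closed_bigcup => //; exact: finite_II.
- by apply: bigcup_open.
- rewrite /G -(bigcup_mkord n F) => x [k _ xF]; exists k => //.
  by have [_ _ /(_ _ xF)] := FUP k.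
- move=> x [k _ xA]; exists k => //.
  by have [_ _ _ /(_ _ xA)] := FUP k.
- apply: (@le_trans _ _ (m (\bigcup_n U n `\` \bigcup_n F n) + m (\bigcup_n F n `\` G n))).
    apply: le_trans (measureU2 _ _ _).
    + apply: le_measure; rewrite ?inE; [exact: measurableD| |].
        by apply: measurableU; exact: measurableD.
      move=> x [xU xG]; have [xF|xF] := pselect ((\bigcup_n F n) x).
        by right.
      by left.
    + exact: measurableD.
    + exact: measurableD.
  by rewrite [d in leRHS]splitr EFinD; apply: leeD.
Qed.

Lemma squeezed_open U : open U -> squeezed U.
Proof.
move=> oU d d0; have mU := open_measurable oU.
have e0 n : (0 < n.+1%:R^-1 :> R)%R by rewrite invr_gt0.
have := inner_part_bigcup oU e0 cvg_harmonic.
pose F n := inner_part n.+1%:R^-1 U; rewrite -/F => FU.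
have [|||n Fn] := @measure_small (fun n => U `\` F n) _ _ _ d d0.
- by move=> n; apply: measurableD => //; exact: measurable_inner_part.
- apply/nonincreasing_seqP => n; rewrite subsetEset; apply: setDS.
  by apply: le_inner_part; rewrite lef_pV2 ?posrE// ler_nat.
- apply/seteqP; split=> // x H; have [xU _] := H 0%N I.
  by move: xU; rewrite -FU => -[n _ xF]; have [_] := H n I.
exists (F n), U; split => //; [exact: closed_inner_part|exact: inner_part_sub].
Qed.

Lemma squeezed_setU A B : squeezed A -> squeezed B -> squeezed (A `|` B).
Proof.
move=> sA sB; rewrite -bigcup2E; apply: squeezed_bigcup => -[|[|n]] //=.
by apply: squeezed_open; exact: open0.
Qed.

Lemma squeezed_ocitv (a b : R) : squeezed `]a, b].
Proof.
rewrite (_ : `]a, b]%classic = setT `\` ((setT `\` `]a, +oo[%classic) `|` `]b, +oo[%classic)).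
  apply: squeezed_setC; apply: squeezed_setU; last by apply: squeezed_open; exact: itv_open_ends_open.
  by apply: squeezed_setC; apply: squeezed_open; exact: itv_open_ends_open.
apply/seteqP; split=> x /=; rewrite !in_itv/= !andbT.
  move=> /andP[ax xb]; split => // -[[_]|]; first exact.
  by rewrite ltNge xb.
move=> [_ /not_orP[h1 /negP]]; rewrite -leNgt => ->; rewrite andbT.
by apply: contrapT => ax; apply: h1.
Qed.

(** The Borel sets are the smallest sigma-algebra containing the half-open intervals, so it suffices
    that the [squeezed] sets form one that contains them. *)
Lemma measurable_squeezed A : measurable A -> squeezed A.
Proof.
apply; split; first split.
- by apply: squeezed_open; exact: open0.
- exact: squeezed_setC.
- exact: squeezed_bigcup.
- move=> _ [[a b] _ <-]; exact: squeezed_ocitv.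
Qed.

End regularity.

Section borel_linear_bound.
Context {R : realType}.
Implicit Types (x h : R) (A : set R).

Lemma mass_outer_regular (m : {measure set R -> \bar R}) A x h d : radon m ->
  measurable A -> 0 < h -> 0 < d ->
  exists U, [/\ open U, A `<=` U & mass m U x h <= mass m A x h + d].
Proof.
move=> rad mA h0 d0.
(* Restricting to the tent's ball makes the measure finite, and the tent sees nothing outside it. *)
pose mr : {measure set R -> \bar R} := mrestr m (measurable_oball x h).
have mrT : (mr setT < +oo)%E by rewrite /mr /= /mrestr setTI; exact: rad.
have [F [U [cF oU FA AU UF]]] := measurable_squeezed mrT mA d0.
have mF := closed_measurable cF; have mU := open_measurable oU.
exists U; split => //; rewrite -lee_fin EFinD !massE//.
have mUA : measurable (U `\` A) by exact: measurableD.
rewrite -{1}(setDUK AU) ge0_integral_setU//; last 2 first.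
- by move=> y _; rewrite lee_fin hat_ge0.
- by rewrite disj_set2E setDIK.
apply: leeD => //; apply: le_trans (int_hat_le _ x mUA h0) _.
apply: le_trans UF; rewrite /mr /= /mrestr setIC; apply: le_measure.
- by rewrite inE; exact: measurableI.
- by rewrite inE; apply: measurableI => //; exact: measurableD.
- by apply: setSI; exact: setDS.
Qed.

Variables (mu nu : {measure set R -> \bar R}) (c K : R).
Hypotheses (rmu : radon mu) (rnu : radon nu) (c0 : 0 < c).
Let M := mass mu setT.
Let N := mass nu setT.
Hypotheses (rM : refining M c) (rN : refining N c).
Hypothesis (Kbound : forall k x h, 0 < h -> cumul M (chi2 M N) k x h <= K * M x h).
Let e := bellman_eps c (3 * c^-1) K.

Lemma mass_linear_bound A x h l : measurable A -> 0 < h -> 0 < l ->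
  mass nu A x h / N x h <= l * (mass mu A x h / M x h) + 2 * l `^ (- e).
Proof.
move=> mA h0 l0.
have [M0 _ _] := rM x h0; have [N0 _ _] := rN x h0.
(* This scaling by the ratio at the root turns s^(-e) M (N/M)^(1+e) into l^(-e) N. *)
set s := l * (N x h / M x h).
have Z0 : 0 < N x h / M x h by rewrite divr_gt0.
have s0 : 0 < s by rewrite mulr_gt0.
have open_case U : open U -> mass nu U x h <= s * mass mu U x h + 2 * l `^ (- e) * N x h.
  move=> oU; apply: mass_open_le => // k.
  apply: le_trans (mass_inner_le_leaves rnu U k x h0) _.
  apply: le_trans (carleson_linear_bound rM rN c0 Kbound (inside U) k x h0 s0) _.
  apply: lerD.
    rewrite ler_wpM2l ?(ltW s0)//; apply: leaves_le_mass => //.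
    exact: open_measurable.
  rewrite /s -/e; have NE : N x h = M x h * (N x h / M x h) by rewrite mulrC divfK ?gt_eqF.
  rewrite [in leRHS]NE; set z := N x h / M x h in Z0 *.
  rewrite (powRM _ (ltW l0) (ltW Z0)).
  rewrite powRD; last by rewrite (gt_eqF Z0) implybT.
  rewrite powRr1 ?(ltW Z0)// [z `^ (- e)]powRN.
  rewrite le_eqVlt; apply/orP; left; apply/eqP; field.
  by rewrite gt_eqF// powR_gt0.
rewrite ler_pdivrMr// mulrDl.
have -> : l * (mass mu A x h / M x h) * N x h = s * mass mu A x h.
  by rewrite /s; field; rewrite gt_eqF.
apply/ler_addgt0Pr => d d0.
have ds0 : 0 < d / s by rewrite divr_gt0.
have [U [oU AU Ud]] := mass_outer_regular x rmu mA h0 ds0.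
apply: le_trans (le_mass rnu x mA (open_measurable oU) h0 AU) _.
apply: (le_trans (open_case U oU)).
have := ler_wpM2l (ltW s0) Ud.
by rewrite mulrDr [s * (d / s)]mulrC divfK ?gt_eqF//; lra.
Qed.

End borel_linear_bound.

(** * Layer-cake estimate *)

Section dyadic_levels.
Context {R : realType}.
Implicit Types (g w : R) (n k r : nat).

(** A geometric sum of ratio 2^r >= 2 is at most twice its last term, here at most g^r. *)
Lemma dyadic_sum_le n r g : (0 < r)%N -> 0 <= g ->
  \sum_(k < n) (2 ^+ k) ^+ r * (2 ^+ k < g)%R%:R <= 2 * g ^+ r * (1 < g)%R%:R.
Proof.
move=> r0 g0.
have q2 : 2 <= (2 : R) ^+ r.
  by case: r r0 => // r _; rewrite exprS ler_peMr// exprn_ege1// ler1n.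
have S_le m : \sum_(k < m) (2 ^+ k) ^+ r * (2 ^+ k < g)%R%:R <= ((2 : R) ^+ m) ^+ r.
  elim: m => [|m IH]; first by rewrite big_ord0 exprn_ge0// exprn_ge0.
  rewrite big_ord_recr /= exprS exprMn.
  have hm : 0 <= ((2 : R) ^+ m) ^+ r by rewrite exprn_ge0// exprn_ge0.
  have : (2 ^+ m) ^+ r * (2 ^+ m < g)%R%:R <= ((2 : R) ^+ m) ^+ r.
    by case: ltP => _; rewrite ?mulr1 ?mulr0.
  have := ler_wpM2r hm q2; lra.
elim: n => [|n IH].
  by rewrite big_ord0 !mulr_ge0// exprn_ge0.
rewrite big_ord_recr /=; have [gn|] := ltP (2 ^+ n) g; last by rewrite mulr0 addr0.
have g1 : 1 < g by apply: le_lt_trans gn; rewrite exprn_ege1// ler1n.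
have := S_le n; rewrite g1 !mulr1.
have : ((2 : R) ^+ n) ^+ r <= g ^+ r by rewrite lerXn2r ?nnegrE ?exprn_ge0// ltW.
lra.
Qed.

Lemma dyadic_level g : 1 < g -> exists k, 2 ^+ k < g <= 2 ^+ k.+1.
Proof.
move=> g1; have [n gn] : exists n, g <= 2 ^+ n.
  exists (Num.trunc g).+1; apply: ltW; apply: (lt_le_trans (truncnS_gt _)).
  by rewrite -natrX ler_nat ltnW// ltn_expl.
case: (ex_minnP (ex_intro (fun n => g <= 2 ^+ n) n gn)) => -[|k] gk min_k.
  by move: g1; rewrite ltNge -[1](expr0 2) gk.
exists k; rewrite gk andbT ltNge; apply/negP => /min_k.
by rewrite ltnn.
Qed.

End dyadic_levels.

Section superlevel.
Context {R : realType}.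
Implicit Types (g : R -> R) (a : R).

Lemma measurable_superlevel g a : measurable_fun setT g -> measurable [set y | a < g y].
Proof.
move=> mg; rewrite (_ : [set _ | _] = setT `&` g @^-1` `]a, +oo[%classic).
  by apply: mg => //; exact: measurable_itv.
by apply/seteqP; split=> y /=; rewrite in_itv/= andbT // => -[].
Qed.

Lemma indic_superlevel g a y : \1_[set y | a < g y] y = (a < g y)%R%:R :> R.
Proof.
rewrite indicE; have [ag|ga] := ltP a (g y); first by rewrite mem_set.
by rewrite memNset//=; apply/negP; rewrite -leNgt.
Qed.

Lemma measurable_fun_superlevel g a :
  measurable_fun setT g -> measurable_fun setT (fun y => (a < g y)%R%:R : R).
Proof.
move=> mg; rewrite (_ : (fun y => _) = \1_[set y | a < g y]).
  by apply: measurable_indic; exact: measurable_superlevel.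
by apply/funext => y; rewrite indic_superlevel.
Qed.

End superlevel.

Section level_bound.
Context {R : realType}.
Implicit Types (x h : R) (g : R -> R).

Lemma mass_indic (m : {measure set R -> \bar R}) A x h : radon m -> measurable A -> (0 < h)%R ->
  (mass m A x h)%:E = (\int[m]_y (hat x h y * \1_A y)%:E)%E.
Proof.
move=> rad mA h0; rewrite massE// integral_mkcond epatch_indic.
by apply: eq_integral => y _; rewrite EFinM.
Qed.

Lemma nneseries_le_fin (u : nat -> \bar R) (b : \bar R) : (forall n, 0 <= u n)%E ->
  (forall n, \sum_(k < n) u k <= b)%E -> (\sum_(k <oo) u k <= b)%E.
Proof.
move=> u0 H; apply: lime_le; first exact: is_cvg_nneseries.
by apply: nearW => n; rewrite big_mkord.
Qed.

Variables (mu nu : {measure set R -> \bar R}) (P : nat) (e : R).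
Hypotheses (rmu : radon mu) (rnu : radon nu) (e0 : (0 < e)%R) (Pe : (2 <= P%:R * e)%R).
Let M := mass mu setT.
Let N := mass nu setT.
Variables (x h : R).
Hypotheses (h0 : (0 < h)%R) (M0 : (0 < M x h)%R) (N0 : (0 < N x h)%R).
Hypothesis bound : forall A l, measurable A -> (0 < l)%R ->
  (mass nu A x h / N x h <= l * (mass mu A x h / M x h) + 2 * l `^ (- e))%R.

Lemma level_bound A k : measurable A ->
  (2 ^+ k.+1 * mass nu A x h <=
   N x h / M x h * (2 * 4 ^+ P) * ((2 ^+ k) ^+ P.+1 * mass mu A x h) +
   N x h * (2^-1 / (2 ^ k.+1)%:R))%R.
Proof.
move=> mA.
(* With l = t^P and P e >= 2 the error l^(-e) is at most t^-2 = 1/(16 4^k). Times 2^(k+1) and 2 N,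
   this is the k-th term of a series with sum N/2. *)
pose t : R := (4 * 2 ^+ k)%R.
have k1 : (1 <= 2 ^+ k :> R)%R by rewrite exprn_ege1// ler1n.
have t1 : (1 <= t)%R by rewrite /t; lra.
have t0 : (0 < t)%R by lra.
have l0 : (0 < t ^+ P)%R by rewrite exprn_gt0.
have := bound mA l0.
have te : ((t ^+ P) `^ (- e) <= t ^- 2)%R.
  rewrite -powR_mulrn ?(ltW t0)// -powRrM -[t ^+ 2]powR_mulrn ?(ltW t0)// -powRN.
  by rewrite ler_powR// mulrN lerN2.
rewrite ler_pdivrMr// => H.
apply: le_trans (ler_wpM2l _ H) _; first by rewrite exprn_ge0.
have {}te := ler_wpM2l (_ : 0 <= 2 ^+ k.+1 * 2 * N x h)%R te.
have -> : (2 ^+ k.+1 * ((t ^+ P * (mass mu A x h / M x h) + 2 * (t ^+ P) `^ (- e)) * N x h) =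
  N x h / M x h * (2 * 4 ^+ P) * ((2 ^+ k) ^+ P.+1 * mass mu A x h) +
  2 ^+ k.+1 * 2 * N x h * (t ^+ P) `^ (- e))%R.
  by rewrite /t exprMn !exprS; field; rewrite gt_eqF.
rewrite lerD2l; apply: le_trans (te _) _.
  by rewrite !mulr_ge0 ?exprn_ge0// ltW.
rewrite le_eqVlt; apply/orP; left; apply/eqP.
rewrite natrX /t exprS; field.
by rewrite expf_neq0.
Qed.

Local Open Scope ereal_scope.

Let integrand_ge0 (A : set R) (y : R) : (0 <= hat x h y * \1_A y)%R.
Proof. by rewrite mulr_ge0 ?hat_ge0// indicE. Qed.

(** The levels enter twice: g 1_{g>1} is below the sum of 2^(k+1) 1_{g>2^k}, and the factors
    (2^k)^(P+1) from [level_bound] sum back to at most 2 g^(P+1). What matters later is that the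
    additive error is a fraction of N below 1. *)
Lemma hat_layer_bound g : (forall y, 0 <= g y)%R -> measurable_fun setT g ->
  \int[nu]_y (hat x h y * (g y * (1 < g y)%R%:R))%:E <=
  (N x h / 2)%:E +
  (N x h / M x h * 4 ^+ P.+1)%:E * \int[mu]_y (hat x h y * (g y ^+ P.+1 * (1 < g y)%R%:R))%:E.
Proof.
move=> g0 mg.
pose A k := [set y | (2 ^+ k < g y)%R].
have mA k : measurable (A k) by exact: measurable_superlevel.
have AE k y : \1_(A k) y = (2 ^+ k < g y)%R%:R :> R by rewrite indic_superlevel.
have mhA k c : measurable_fun setT (fun y => (c * (hat x h y * \1_(A k) y))%:E).
  apply/measurable_EFinP; apply: measurable_funM; first exact: measurable_cst.
  by apply: measurable_funM; [exact: measurable_hat|exact: measurable_indic].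
apply: (@le_trans _ _ (\int[nu]_y \sum_(k <oo) (2 ^+ k.+1 * (hat x h y * \1_(A k) y))%:E)).
  apply: ge0_le_integral_nonmeas => y _.
    by rewrite lee_fin !mulr_ge0 ?hat_ge0.
  have [g1|g1] := ltP 1%R (g y); last first.
    by rewrite !mulr0 nneseries_ge0// => k _ _; rewrite lee_fin mulr_ge0 ?integrand_ge0// exprn_ge0.
  have [k /andP[kg gk]] := dyadic_level g1.
  apply: (@le_trans _ _ (2 ^+ k.+1 * (hat x h y * \1_(A k) y))%:E).
    by rewrite AE kg !mulr1 lee_fin mulrC ler_wpM2r ?hat_ge0.
  apply: le_trans (nneseries_lim_ge k.+1 _); last first.
    by move=> i _ _; rewrite lee_fin mulr_ge0 ?integrand_ge0// exprn_ge0.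
  rewrite big_mkord big_ord_recr /= leeDr// sume_ge0// => i _.
  by rewrite lee_fin mulr_ge0 ?integrand_ge0// exprn_ge0.
rewrite integral_nneseries//; last first.
  by move=> k y _; rewrite lee_fin mulr_ge0 ?integrand_ge0// exprn_ge0.
have intE (m : {measure set R -> \bar R}) c k : radon m -> (0 <= c)%R ->
    \int[m]_y (c * (hat x h y * \1_(A k) y))%:E = (c * mass m (A k) x h)%:E.
  move=> rm c00; rewrite EFinM mass_indic// -ge0_integralZl_EFin//.
    by move=> y _; rewrite lee_fin.
  by apply/measurable_EFinP; apply: measurable_funM; [exact: measurable_hat|exact: measurable_indic].
under eq_eseriesr do rewrite intE ?exprn_ge0//.
have c1 : (0 <= N x h / M x h * (2 * 4 ^+ P))%R.
  by rewrite mulr_ge0 ?divr_ge0 ?ltW// ?mulr_gt0 ?exprn_gt0.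
apply: (@le_trans _ _ (\sum_(k <oo) (
    (N x h / M x h * (2 * 4 ^+ P) * ((2 ^+ k) ^+ P.+1 * mass mu (A k) x h))%:E +
    (N x h)%:E * (2^-1 / (2 ^ k.+1)%:R)%:E))).
  apply: lee_nneseries => k _; first by rewrite lee_fin mulr_ge0 ?mass_ge0// exprn_ge0.
  by rewrite -EFinM -EFinD lee_fin level_bound.
have qk0 k : (0 <= (2 ^+ k : R) ^+ P.+1)%R by rewrite exprn_ge0// exprn_ge0.
rewrite nneseriesD; last 2 first.
- by move=> k _ _; rewrite lee_fin; apply: mulr_ge0 => //; rewrite mulr_ge0 ?mass_ge0.
- by move=> k _ _; rewrite mule_ge0 ?lee_fin ?(ltW N0)// divr_ge0.
rewrite addeC; apply: leeD.
  rewrite nneseriesZl; last by move=> k _; rewrite lee_fin divr_ge0.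
  by rewrite EFinM lee_wpmul2l ?lee_fin ?(ltW N0)//; exact: epsilon_trick0.
under eq_eseriesr do rewrite EFinM.
rewrite nneseriesZl; last by move=> k _; rewrite lee_fin mulr_ge0 ?mass_ge0// exprn_ge0// exprn_ge0.
rewrite (_ : N x h / M x h * 4 ^+ P.+1 = N x h / M x h * (2 * 4 ^+ P) * 2)%R; last first.
  by rewrite exprS; ring.
rewrite [in leRHS]EFinM -muleA lee_wpmul2l ?lee_fin//.
rewrite -ge0_integralZl_EFin//; last 2 first.
- by move=> y _; rewrite lee_fin !mulr_ge0 ?hat_ge0// exprn_ge0.
- apply/measurable_EFinP; apply: measurable_funM; first exact: measurable_hat.
  by apply: measurable_funM; [exact: measurable_funX|exact: measurable_fun_superlevel].
rewrite (eq_eseriesr (g := fun k => \int[mu]_y ((2 ^+ k) ^+ P.+1 * (hat x h y * \1_(A k) y))%:E)); last first.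
  by move=> k _; rewrite intE// exprn_ge0// exprn_ge0.
rewrite -integral_nneseries//; last first.
  by move=> k y _; rewrite lee_fin mulr_ge0 ?integrand_ge0// exprn_ge0// exprn_ge0.
apply: ge0_le_integral_nonmeas => y _.
  by rewrite nneseries_ge0// => k _ _; rewrite lee_fin mulr_ge0 ?integrand_ge0// exprn_ge0// exprn_ge0.
apply: nneseries_le_fin => n.
  by rewrite lee_fin mulr_ge0 ?integrand_ge0// exprn_ge0// exprn_ge0.
rewrite sumEFin -EFinM lee_fin.
have := ler_wpM2l (hat_ge0 x h y) (dyadic_sum_le n (ltn0Sn P) (g0 y)).
rewrite mulr_sumr => H; apply: le_trans (le_trans _ H) _.
  by apply: ler_sum => k _; rewrite AE mulrCA.
by rewrite le_eqVlt; apply/orP; left; apply/eqP; ring.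
Qed.

End level_bound.

(** * Weak type *)

Section vitali_weak_type.
Context {R : realType}.
Implicit Types (x h : R).
Variables (mu : {measure set R -> \bar R}) (D : R).
Hypotheses (rmu : radon mu) (D1 : 1 <= D) (dmu : doubling_with mu D).
Local Open Scope ereal_scope.

(** Disjoint balls are selected from a finite subcover so that their triples still cover K; the
    triples cost 2 D^3 since 3h <= 2^3 (h/2), and disjointness lets the integrals of G add up. *)
Lemma vitali_compact (K : set R) (G : R -> \bar R) (B : R) :
  compact K -> measurable_fun setT G -> (forall y, 0 <= G y) -> (0 <= B)%R ->
  (forall x, K x -> exists c h, [/\ (0 < h)%R, oball c h x &
     (mass mu setT c h)%:E <= B%:E * \int[mu]_(y in oball c h) G y]) ->
  mu K <= (2 * D ^+ 3 * B)%:E * \int[mu]_y G y.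
Proof.
move=> cK mG G0 B0 KH.
have mK : measurable K by exact: compact_measurable.
have /choice[p pP] : forall x, exists p : R * R, (0 < p.2)%R /\ (K x -> oball p.1 p.2 x /\
     (mass mu setT p.1 p.2)%:E <= B%:E * \int[mu]_(y in oball p.1 p.2) G y).
  (* Points outside K get a dummy ball of radius 1, so that the choice function is total with
     positive radii. *)
  move=> x; have [Kx|Kx] := pselect (K x); last by exists (0%R, 1%R).
  by have [c [h [h0 cx H]]] := KH x Kx; exists (c, h).
have p0 x : (0 < (p x).2)%R by have [] := pP x.
pose b x := ball (p x).1 (p x).2.
have Kb : K `<=` cover K b.
  by move=> x Kx; exists x => //; rewrite /b -oball_ball; have [_ /(_ Kx)[]] := pP x.
have [S SK KS] : finite_subset_cover K b K.
  move: cK; rewrite compact_cover => /(_ _ _ _ _ Kb); apply.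
  by move=> x _; exact: ball_open.
have b_ball x : is_ball (b x) by exact: is_ball_ball.
have b0 x : b x !=set0 by exists (p x).1; exact: ballxx.
have [E [uE ES tE SE]] := @vitali_lemma_finite_cover _ _ b b_ball b0 (finmap.enum_fset S).
have {}KS : K `<=` cover [set` E] (scale_ball 3%:R \o b).
  apply: subset_trans SE; apply: subset_trans KS _.
  by move=> x [r rS xr]; exists r.
have mb x : measurable (b x) by exact: measurable_ball.
apply: (@le_trans _ _ (\sum_(i <- E) mu (oball (p i).1 (3 * (p i).2)))).
  rewrite (big_nth 0%R) big_mkord.
  apply: (@content_subadditive _ _ _ mu K
      (fun i => oball (p (nth 0%R E i)).1 (3 * (p (nth 0%R E i)).2)) (size E)) => //.
  apply: subset_trans KS _ => x [i /= iE]; rewrite /b scale_ballE// -oball_ball => xi.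
  rewrite -(bigcup_mkord (size E) (fun k => oball (p (nth 0%R E k)).1 (3 * (p (nth 0%R E k)).2))).
  exists (index i E); first by rewrite /= index_mem.
  by rewrite nth_index.
apply: (@le_trans _ _ (\sum_(i <- E) (2 * D ^+ 3 * B)%:E * \int[mu]_(y in b i) G y)).
  rewrite big_seq [leRHS]big_seq; apply: lee_sum => i iE.
  have iK : K i by apply: set_mem; apply: SK; exact: ES.
  have [_ /(_ iK)[_ H]] := pP i.
  apply: le_trans (oball_le_mass rmu D1 dmu (k := 3) (x := (p i).1) (p0 i) _) _.
    by rewrite subrr normr0 add0r; have := p0 i; lra.
  have D3 : (0 <= 2 * D ^+ 3)%R by rewrite mulr_ge0// exprn_ge0// (le_trans ler01).
  by rewrite EFinM [in leRHS]EFinM -muleA lee_wpmul2l ?lee_fin// /b -oball_ball.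
have c0 : (0 <= 2 * D ^+ 3 * B)%R.
  by rewrite mulr_ge0// mulr_ge0// exprn_ge0// (le_trans ler01).
rewrite -ge0_sume_distrr; last by move=> i _; exact: integral_ge0.
rewrite lee_wpmul2l ?lee_fin// -(@ge0_integral_bigsetU _ _ _ mu _ b)//; last by apply: measurable_funTS.
apply: ge0_subset_integral => //.
exact: bigsetU_measurable.
Qed.

Lemma vitali_open (O : set R) (G : R -> \bar R) (B : R) :
  open O -> measurable_fun setT G -> (forall y, 0 <= G y) -> (0 <= B)%R ->
  (forall x, O x -> exists c h, [/\ (0 < h)%R, oball c h x &
     (mass mu setT c h)%:E <= B%:E * \int[mu]_(y in oball c h) G y]) ->
  mu O <= (2 * D ^+ 3 * B)%:E * \int[mu]_y G y.
Proof.
move=> oO mG G0 B0 OH.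
have mO := open_measurable oO.
pose K n := inner_part n.+1%:R^-1 O `&` `[(- n%:R)%R, n%:R].
have mK n : measurable (K n) by apply: measurableI => //; exact: measurable_itv.
have KE : \bigcup_n K n = O.
  have e0 n : (0 < n.+1%:R^-1 :> R)%R by rewrite invr_gt0.
  apply/seteqP; split=> [x [n _ [xK _]]|x]; first exact: inner_part_sub xK.
  rewrite -{1}(inner_part_bigcup oO e0 cvg_harmonic) => -[n _ xn].
  pose k := (Num.trunc `|x|).+1; exists (maxn n k) => //; split.
    apply: le_inner_part xn; rewrite lef_pV2 ?posrE// ler_nat ltnS.
    exact: leq_maxl.
  rewrite /= in_itv/= -ler_norml; apply: (@le_trans _ _ k%:R).
    exact: ltW (truncnS_gt _).
  by rewrite ler_nat leq_maxr.
have ndK : nondecreasing_seq K.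
  apply/nondecreasing_seqP => n; rewrite subsetEset; apply: setISS.
    by apply: le_inner_part; rewrite lef_pV2 ?posrE// ler_nat.
  move=> x /=; rewrite !in_itv/= -!ler_norml => /le_trans; apply.
  by rewrite ler_nat.
have mKU : measurable (\bigcup_n K n) by rewrite KE.
have cv := nondecreasing_cvg_mu (mu := mu) mK mKU ndK.
rewrite -KE -(cvg_lim _ cv)//; apply: lime_le; first by apply/cvg_ex; eexists; exact: cv.
apply: nearW => n; apply: vitali_compact => //.
  rewrite /K setIC; apply: compact_closedI; first exact: segment_compact.
  exact: closed_inner_part.
by move=> x Kx; apply: OH; rewrite -KE; exists n.
Qed.

End vitali_weak_type.

Section maximal_operator.
Context {R : realType}.
Implicit Types (x h : R) (f g : R -> R).
Local Open Scope ereal_scope.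

Lemma maxop_ge0 (nu : {measure set R -> \bar R}) f x : 0 <= maxop nu f x.
Proof.
apply: (@le_trans _ _ ((fine (nu `](x - 1)%R, (x + 1)%R[%classic))^-1%:E *
   \int[nu]_(y in `](x - 1)%R, (x + 1)%R[%classic) (`|f y|)%:E)).
  by rewrite mule_ge0 ?lee_fin ?invr_ge0 ?fine_ge0// integral_ge0// => y _; rewrite lee_fin.
apply: ereal_sup_ubound; exists ((x - 1)%R, (x + 1)%R) => //=.
by apply/andP; split; lra.
Qed.

Lemma open_maxop_level (nu : {measure set R -> \bar R}) f (a : \bar R) :
  open [set x | a < maxop nu f x].
Proof.
rewrite (_ : [set _ | _] = \bigcup_(ab in [set ab : R * R | a < (fine (nu `]ab.1, ab.2[%classic))^-1%:E *
   \int[nu]_(y in `]ab.1, ab.2[%classic) (`|f y|)%:E]) `]ab.1, ab.2[%classic).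
  by apply: bigcup_open => ab _; exact: itv_open.
apply/seteqP; split=> x /=.
  by move=> /ereal_sup_gt[_ [ab abx <-] aab]; exists ab => //=; rewrite in_itv.
move=> [ab /= aab]; rewrite in_itv/= => abx; apply: lt_le_trans aab _.
by apply: ereal_sup_ubound; exists ab.
Qed.

Variables (mu nu : {measure set R -> \bar R}) (P : nat) (D : R).
Hypotheses (rmu : radon mu) (rnu : radon nu) (D1 : (1 <= D)%R).
Hypotheses (dmu : doubling_with mu D) (dnu : doubling_with nu D).
Hypotheses (mu0 : mu setT != 0) (nu0 : nu setT != 0).
Let M := mass mu setT.
Let N := mass nu setT.
Hypothesis layer : forall x h g, (0 < h)%R -> (forall y, 0 <= g y)%R -> measurable_fun setT g ->
  \int[nu]_y (hat x h y * (g y * (1 < g y)%R%:R))%:E <=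
  (N x h / 2)%:E +
  (N x h / M x h * 4 ^+ P.+1)%:E * \int[mu]_y (hat x h y * (g y ^+ P.+1 * (1 < g y)%R%:R))%:E.

(** An interval with nu-average above L is placed where a tent of twice its radius is at least 1/2.
    The scaling 4D/L, with N <= D n, makes the integral of 1 + g 1_{g>1} against the tent exceed 2
    N, so the part with g > 1 exceeds N. The layer bound accounts for only N/2 without mu, so the
    mu-integral must supply the other half; division by N gives the bound on M. *)
Lemma maxop_level f (L x : R) (g := fun y => (4 * D / L * `|f y|)%R) :
  measurable_fun setT f -> (0 < L)%R -> L%:E < maxop nu f x ->
  exists c h, [/\ (0 < h)%R, oball c h x &
    (M c h)%:E <= (2 * 4 ^+ P.+1)%:E * \int[mu]_(y in oball c h) (g y ^+ P.+1 * (1 < g y)%R%:R)%:E].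
Proof.
move=> mf L0 /ereal_sup_gt[_ [[a b] /= /andP[ax xb] <-]].
have ab : (a < b)%R := lt_trans ax xb.
pose c := ((a + b) / 2)%R; pose r := ((b - a) / 2)%R; pose h := (2 * r)%R.
have r0 : (0 < r)%R by rewrite divr_gt0// subr_gt0.
have h0 : (0 < h)%R by rewrite mulr_gt0.
have -> : `]a, b[%classic = oball c r.
  have ca : (c - r)%R = a by rewrite /c /r; field.
  have cb : (c + r)%R = b by rewrite /c /r; field.
  by rewrite /oball ca cb.
have n0 := doubling_gt0 D1 dnu c nu0 r0.
have nE : nu (oball c r) = (fine (nu (oball c r)))%:E by rewrite fineK// measure_oball_fin.
move: n0; rewrite nE lte_fin; set n := fine _ => n0; rewrite [fine _]/=.
rewrite lte_pdivlMl// => HI.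
have D0 : (0 < D)%R by exact: lt_le_trans D1.
have M0 : (0 < M c h)%R by exact: mass_gt0 dmu _ _ _ _.
have N0 : (0 < N c h)%R by exact: mass_gt0 dnu _ _ _ _.
have Nn : (N c h <= D * n)%R.
  rewrite -lee_fin; apply: le_trans (mass_le rnu _ measurableT h0) _; rewrite setIT.
  by apply: le_trans (dnu c r0) _; rewrite nE EFinM.
have g0 y : (0 <= g y)%R by rewrite mulr_ge0// divr_ge0 ?mulr_ge0// ltW.
have mg : measurable_fun setT g.
  apply: measurable_funM; first exact: measurable_cst.
  by apply: measurableT_comp => //; exact: normr_measurable.
have m1 k : measurable_fun setT (fun y => (g y ^+ k * (1 < g y)%R%:R)%R).
  by apply: measurable_funM; [exact: measurable_funX|exact: measurable_fun_superlevel].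
have mh1 k : measurable_fun setT (fun y => (hat c h y * (g y ^+ k * (1 < g y)%R%:R))%:E).
  by apply/measurable_EFinP; apply: measurable_funM => //; exact: measurable_hat.
have hg0 k y : (0 <= hat c h y * (g y ^+ k * (1 < g y)%R%:R))%R.
  by rewrite !mulr_ge0 ?hat_ge0// exprn_ge0.
pose J := \int[nu]_y (hat c h y * (g y * (1 < g y)%R%:R))%:E.
have J_ge : (2 * N c h)%:E < (N c h)%:E + J.
  have -> : (N c h)%:E + J = \int[nu]_y (hat c h y + hat c h y * (g y ^+ 1 * (1 < g y)%R%:R))%:E.
    under [RHS]eq_integral do rewrite EFinD.
    rewrite ge0_integralD//; last 2 first.
    - by move=> y _; rewrite lee_fin hat_ge0.
    - by move=> y _; rewrite lee_fin.
    by rewrite -massE.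
  have HI2 : \int[nu]_(y in oball c r) `|f y|%:E <= (L / (2 * D))%:E *
      \int[nu]_y (hat c h y + hat c h y * (g y ^+ 1 * (1 < g y)%R%:R))%:E.
    rewrite -ge0_integralZl_EFin//; last 3 first.
    - by move=> y _; rewrite lee_fin addr_ge0 ?hat_ge0.
    - by apply/measurable_EFinP; apply: measurable_funD; [exact: measurable_hat|apply/measurable_EFinP; exact: mh1].
    - by rewrite divr_ge0 ?mulr_ge0// ltW.
    rewrite [leLHS]integral_mkcond; apply: ge0_le_integral_nonmeas => y _.
      by rewrite patchE; case: ifP => // _; rewrite lee_fin.
    rewrite patchE -EFinM; case: ifPn => [|_]; last first.
      by rewrite lee_fin mulr_ge0 ?addr_ge0 ?hat_ge0// divr_ge0 ?mulr_ge0// ltW.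
    rewrite inE => yI; rewrite lee_fin.
    have hy : (2^-1 <= hat c h y)%R.
      have := @hat_ge R c h y 2^-1 h0; rewrite /h mulrA mulVf// mul1r => /(_ yI); lra.
    have gy : (g y <= 1 + g y ^+ 1 * (1 < g y)%R%:R)%R.
      rewrite expr1; case: ltP => g1; rewrite ?mulr1 ?mulr0; lra.
    rewrite -[X in (X + _)%R]mulr1 -mulrDr.
    have fE : (`|f y| = L / (4 * D) * g y)%R by rewrite /g; field; rewrite !gt_eqF.
    rewrite fE (_ : L / (4 * D) * g y = L / (2 * D) * (2^-1 * g y))%R; last by field; rewrite gt_eqF.
    apply: ler_wpM2l; first by rewrite divr_ge0 ?mulr_ge0// ltW.
    by apply: ler_pM => //; rewrite invr_ge0.
  have := lt_le_trans HI HI2; set X := \int[nu]_y _ => HX.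
  have L2D : (0 < L / (2 * D))%R by rewrite divr_gt0// mulr_gt0.
  have : (2 * D * n)%:E < X.
    rewrite -(@lte_pmul2l _ (L / (2 * D))%:E) ?lte_fin// -EFinM.
    by rewrite (_ : L / (2 * D) * (2 * D * n) = L * n)%R ?[(L * n)%R]mulrC// ; field; rewrite gt_eqF.
  by apply: le_lt_trans; rewrite lee_fin -mulrA ler_pM2l.
have {J_ge} : (N c h)%:E < J.
  by move: J_ge; rewrite mulr_natl mulr2n EFinD lteD2lE.
move=> /lt_le_trans-/(_ _ (layer c h0 g0 mg)).
set Q := \int[mu]_y _ => NQ.
have QM : (M c h)%:E <= (2 * 4 ^+ P.+1)%:E * Q.
  have : 0 <= Q by apply: integral_ge0 => y _; rewrite lee_fin.
  have c40 : (0 < 2 * 4 ^+ P.+1 :> R)%R by rewrite mulr_gt0// exprn_gt0.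
  move: NQ; case: Q => [q| |] //=.
    rewrite -!EFinM -EFinD lte_fin lee_fin => H q0.
    have : (N c h / 2 < N c h / M c h * 4 ^+ P.+1 * q)%R by lra.
    rewrite (_ : N c h / M c h * 4 ^+ P.+1 * q = N c h * (4 ^+ P.+1 * q / M c h))%R; last by ring.
    by rewrite ltr_pM2l// ltr_pdivlMr// lee_fin; lra.
  by move=> _ _; rewrite gt0_muley ?leey ?lte_fin.
exists c, h; split => //.
  by rewrite oballE /c /h /r ltr_norml; apply/andP; split; lra.
apply: le_trans QM _; rewrite lee_wpmul2l ?lee_fin ?mulr_ge0 ?exprn_ge0//.
rewrite [leRHS]integral_mkcond; apply: ge0_le_integral_nonmeas => y _.
  by rewrite lee_fin.
rewrite patchE; case: ifPn => [_|/negP]; rewrite ?inE.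
  by rewrite lee_fin ler_piMl ?hat_le1// mulr_ge0// exprn_ge0.
by move=> yc; rewrite hat_out ?mul0r.
Qed.

Lemma maxop_weak_type f (L : R) (g := fun y => (4 * D / L * `|f y|)%R) :
  measurable_fun setT f -> (0 < L)%R ->
  mu [set x | L%:E < maxop nu f x] <=
  (2 * D ^+ 3 * (2 * 4 ^+ P.+1))%:E * \int[mu]_y (g y ^+ P.+1 * (1 < g y)%R%:R)%:E.
Proof.
move=> mf L0.
have mg : measurable_fun setT g.
  apply: measurable_funM; first exact: measurable_cst.
  by apply: measurableT_comp => //; exact: normr_measurable.
apply: vitali_open => //.
- exact: open_maxop_level.
- apply/measurable_EFinP; apply: measurable_funM; first exact: measurable_funX.
  exact: measurable_fun_superlevel.
- move=> y; rewrite lee_fin mulr_ge0// exprn_ge0// mulr_ge0// divr_ge0 ?(ltW L0)//.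
  by rewrite mulr_ge0// (le_trans ler01).
- by move=> x xL; exact: maxop_level.
Qed.

End maximal_operator.

(** * Strong type *)

Section limn_einf_bounds.
Context {R : realType}.
Implicit Types (u : (\bar R)^nat) (b : \bar R).
Local Open Scope ereal_scope.

Lemma limn_einf_ge u b n : (forall k, (n <= k)%N -> b <= u k) -> b <= limn_einf u.
Proof.
move=> H; rewrite limn_einf_lim (cvg_lim _ (@cvg_einfs_sup _ u))//.
apply: (@le_trans _ _ (einfs u n)); last by apply: ereal_sup_ubound; exists n.
by apply: le_ereal_inf_tmp => _ [k /= nk <-]; exact: H.
Qed.

Lemma limn_einf_le u b : (forall k, u k <= b) -> limn_einf u <= b.
Proof.
move=> H; rewrite limn_einf_lim (cvg_lim _ (@cvg_einfs_sup _ u))//.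
apply: ge_ereal_sup => _ [n _ <-]; apply: le_trans (H n).
by apply: ereal_inf_lbound; exists n => //=.
Qed.

End limn_einf_bounds.

Section dyadic_power.
Context {R : realType}.
Implicit Types (w : \bar R) (n j p : nat).

(** The power 2^(j-n) indexed by naturals: j < 2n runs through 2^-n, ..., 2^(n-1). *)
Definition level n j : R := 2 ^+ j / 2 ^+ n.

Lemma level_gt0 n j : 0 < level n j.
Proof. by rewrite divr_gt0 ?exprn_gt0. Qed.

(* A finite sum over dyadic levels that dominates [w ^ p] as soon as [2^-n < w <= 2^n]. *)
Definition dyadic_power p n w : R :=
  \sum_(j < n + n) (2 * level n j) ^+ p * ((level n j)%:E < w)%E%:R.

Lemma dyadic_power_term p n w j : (j < n + n)%N -> ((level n j)%:E < w)%E ->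
  (2 * level n j) ^+ p <= dyadic_power p n w.
Proof.
move=> jn jw; rewrite /dyadic_power (bigD1 (Ordinal jn))//= jw mulr1 lerDl.
by apply: sumr_ge0 => i _; rewrite mulr_ge0// exprn_ge0// mulr_ge0// ltW// level_gt0.
Qed.

Lemma dyadic_power_ge0 p n w : 0 <= dyadic_power p n w.
Proof.
by apply: sumr_ge0 => i _; rewrite mulr_ge0// exprn_ge0// mulr_ge0// ltW// level_gt0.
Qed.

(** The lower limit is the form that Fatou's lemma takes, and it includes w = +oo, where the top
    level alone contributes (2^n)^p. A finite w > 0 is caught between consecutive levels once n is
    large. *)
Lemma poweR_le_dyadic p w : (0 < p)%N -> (0 <= w)%E ->
  (w `^ p%:R <= limn_einf (fun n => (dyadic_power p n w)%:E))%E.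
Proof.
move=> p0; case: w => [w| |] // w0.
- rewrite lee_fin in w0; rewrite poweR_EFin powR_mulrn//.
  move: w0; rewrite le_eqVlt => /predU1P[<-|w0].
    apply: (@limn_einf_ge _ _ _ 0%N) => n _.
    by rewrite expr0n eqn0Ngt p0 /= lee_fin dyadic_power_ge0.
  pose n0 := (Num.trunc w + Num.trunc w^-1).+1.
  apply: (@limn_einf_ge _ _ _ n0) => n n0n; rewrite lee_fin.
  have n2 : n%:R < 2 ^+ n :> R by rewrite -natrX ltr_nat ltn_expl.
  have wn : w < 2 ^+ n.
    apply: le_lt_trans n2; apply: ltW; apply: (lt_le_trans (truncnS_gt _)).
    by rewrite ler_nat (leq_trans _ n0n)// ltnS leq_addr.
  have wVn : w^-1 < 2 ^+ n.
    apply: le_lt_trans n2; apply: ltW; apply: (lt_le_trans (truncnS_gt _)).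
    by rewrite ler_nat (leq_trans _ n0n)// ltnS leq_addl.
  have n20 : 0 < 2 ^+ n :> R by rewrite exprn_gt0.
  have g1 : 1 < 2 ^+ n * w by rewrite -ltr_pdivrMr// mul1r.
  have [k /andP[kw wk]] := dyadic_level g1.
  have kn : (k < n + n)%N.
    rewrite -(@ltr_eXn2l R 2) ?ltr1n//; apply: lt_trans kw _.
    by rewrite exprD ltr_pM2l.
  apply: le_trans (dyadic_power_term p kn _).
    rewrite lerXn2r ?nnegrE ?(ltW w0)//; first by rewrite mulr_ge0// ltW// level_gt0.
    by rewrite /level mulrA -exprS ler_pdivlMr// mulrC.
  by rewrite lte_fin /level ltr_pdivrMr// mulrC.
- have pn0 : p%:R != 0 :> R by rewrite pnatr_eq0 -lt0n.
  rewrite poweRE (negbTE pn0) eqxx.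
  suff -> : limn_einf (fun n => (dyadic_power p n +oo)%:E) = +oo%E by [].
  apply/eq_infty => t.
  apply: (@limn_einf_ge _ _ _ (Num.trunc t).+1) => n tn; rewrite lee_fin.
  have n0 : (0 < n)%N by exact: leq_ltn_trans tn.
  have jn : ((n + n).-1 < n + n)%N by rewrite prednK// addn_gt0 n0.
  apply: le_trans (dyadic_power_term p jn (ltry _)).
  have -> : 2 * level n (n + n).-1 = 2 ^+ n.
    by rewrite /level mulrA -exprS prednK ?addn_gt0 ?n0// exprD mulfK// gt_eqF// exprn_gt0.
  apply: (@le_trans _ _ n%:R).
    by apply: ltW; apply: (lt_le_trans (truncnS_gt _)); rewrite ler_nat.
  apply: (@le_trans _ _ (2 ^+ n)).
    by rewrite -natrX ler_nat ltnW// ltn_expl.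
  by rewrite -[leLHS]expr1 ler_weXn2l// exprn_ege1// ler1n.
Qed.

Lemma level_sum_le n (w : R) : 0 <= w ->
  \sum_(j < n + n) level n j * (level n j < w)%R%:R <= 2 * w.
Proof.
move=> w0; have n20 : 0 < 2 ^+ n :> R by rewrite exprn_gt0.
have := @dyadic_sum_le R (n + n) 1 (2 ^+ n * w) isT (mulr_ge0 (ltW n20) w0).
rewrite expr1 => H.
have {H} : \sum_(k < n + n) (2 ^+ k) ^+ 1 * (2 ^+ k < 2 ^+ n * w)%R%:R <= 2 * (2 ^+ n * w).
  apply: le_trans H _; rewrite -[leRHS]mulr1 ler_wpM2l//; last by case: ltP.
  by rewrite mulr_ge0// mulr_ge0// ltW.
rewrite mulrCA -ler_pdivrMl// mulr_sumr; apply: le_trans.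
apply: ler_sum => j _; rewrite expr1 /level ltr_pdivrMr// [w * _]mulrC.
by rewrite mulrA [(_ ^-1) * _]mulrC.
Qed.

End dyadic_power.

Section strong_type.
Context {R : realType}.
Variables (mu nu : {measure set R -> \bar R}) (P : nat) (b C : R).
Hypotheses (b0 : 0 < b) (C0 : 0 <= C).
Hypothesis weak : forall (f : R -> R) (L : R), measurable_fun setT f -> 0 < L ->
  (mu [set x | L%:E < maxop nu f x] <=
   C%:E * \int[mu]_y ((b / L * `|f y|) ^+ P.+1 * (1 < b / L * `|f y|)%R%:R)%:E)%E.

(** Marcinkiewicz interpolation by hand. At level s the weak bound gives s^(P+2) (w/s)^(P+1) 1_{w>s}
    = s w^(P+1) 1_{w>s}, with w = b |f|; the one spare power of s makes the sum over dyadic levels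
    geometric, at most 2 w^(P+2). *)
Lemma maxop_strong_type (f : R -> R) : measurable_fun setT f ->
  (\int[mu]_x ((maxop nu f x) `^ P.+2%:R) <=
   (C * 2 ^+ P.+3 * b ^+ P.+2)%:E * \int[mu]_x (`|f x| `^ P.+2%:R)%:E)%E.
Proof.
move=> mf; pose H n x := (dyadic_power P.+2 n (maxop nu f x))%:E.
have mO L : measurable [set x | (L%:E < maxop nu f x)%E].
  by apply: open_measurable; exact: open_maxop_level.
have mabs : measurable_fun setT (fun y => `|f y|).
  by apply: measurableT_comp => //; exact: normr_measurable.
have ind L x : ((L%:E < maxop nu f x)%E%:R : R) = \1_[set x | (L%:E < maxop nu f x)%E] x.
  rewrite indicE; case: ltP => h; first by rewrite mem_set.
  by rewrite memNset//=; apply/negP; rewrite -leNgt.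
have HE n x : (H n x = \sum_(j < n + n) ((2 * level n j) ^+ P.+2)%:E *
   (\1_[set x | ((level n j)%:E < maxop nu f x)%E] x)%:E)%E.
  by rewrite /H /dyadic_power -sumEFin; apply: eq_bigr => j _; rewrite EFinM ind.
have l20 n j : 0 <= (2 * level n j) ^+ P.+2 :> R.
  by rewrite exprn_ge0// mulr_ge0// ltW// level_gt0.
have mind n j : measurable_fun setT (fun x => (((2 * level n j) ^+ P.+2)%:E *
   (\1_[set x | ((level n j)%:E < maxop nu f x)%E] x)%:E)%E).
  by apply: measurable_funeM; apply/measurable_EFinP; exact: measurable_indic.
have mH n : measurable_fun setT (H n).
  have -> : H n = (fun x => \sum_(j < n + n) ((2 * level n j) ^+ P.+2)%:E *
     (\1_[set x | ((level n j)%:E < maxop nu f x)%E] x)%:E)%E.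
    by apply/funext => x; rewrite HE.
  by apply: emeasurable_sum => j; exact: mind.
have H0 n x : (0 <= H n x)%E by rewrite lee_fin dyadic_power_ge0.
apply: (@le_trans _ _ (\int[mu]_x limn_einf (H^~ x))%E).
  apply: ge0_le_integral_nonmeas => x _; first exact: poweR_ge0.
  by apply: poweR_le_dyadic => //; exact: maxop_ge0.
apply: le_trans (fatou _ _ _ _) _ => //.
apply: limn_einf_le => n.
under eq_integral do rewrite HE.
rewrite ge0_integral_sum//; last first.
  by move=> j x _; rewrite mule_ge0 ?lee_fin// indicE.
pose w y := b * `|f y|.
have w0 y : 0 <= w y by rewrite mulr_ge0// ltW.
have mw : measurable_fun setT w by apply: measurable_funM => //; exact: measurable_cst.
have mG n' j : measurable_fun setT (fun y => ((2 ^+ P.+2 * (level n' j * (level n' j < w y)%R%:R) * w y ^+ P.+1))%:E).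
  apply/measurable_EFinP; apply: measurable_funM; last exact: measurable_funX.
  apply: measurable_funM; first exact: measurable_cst.
  apply: measurable_funM; first exact: measurable_cst.
  exact: measurable_fun_superlevel.
have G0 n' j y : 0 <= 2 ^+ P.+2 * (level n' j * (level n' j < w y)%R%:R) * w y ^+ P.+1.
  by rewrite mulr_ge0 ?exprn_ge0// mulr_ge0 ?exprn_ge0// mulr_ge0// ltW// level_gt0.
apply: (@le_trans _ _ (\sum_(j < n + n) C%:E *
   \int[mu]_y ((2 ^+ P.+2 * (level n j * (level n j < w y)%R%:R) * w y ^+ P.+1))%:E)%E).
  apply: lee_sum => j _; have lv0 := @level_gt0 R n j.
  rewrite ge0_integralZl_EFin//; last first.
    by apply/measurable_EFinP; exact: measurable_indic.
  rewrite integral_indic// setIT.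
  have l2 := l20 n j; rewrite -lee_fin in l2.
  apply: (le_trans (lee_wpmul2l l2 (weak mf lv0))).
  rewrite muleCA lee_wpmul2l ?lee_fin// -ge0_integralZl_EFin//; last 2 first.
  - move=> y _; rewrite lee_fin mulr_ge0// exprn_ge0// mulr_ge0// divr_ge0// ltW//.
  - apply/measurable_EFinP; apply: measurable_funM.
      by apply: measurable_funX; apply: measurable_funM => //; exact: measurable_cst.
    apply: (@measurable_fun_superlevel _ (fun y => b / level n j * `|f y|)).
    by apply: measurable_funM => //; exact: measurable_cst.
  apply: ge0_le_integral_nonmeas => y _.
    rewrite -EFinM lee_fin mulr_ge0// mulr_ge0// exprn_ge0// mulr_ge0// divr_ge0// ltW//.
  rewrite -EFinM lee_fin /w.
  have -> : (1 < b / level n j * `|f y|) = (level n j < b * `|f y|).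
    by rewrite mulrAC ltr_pdivlMr// mul1r.
  rewrite le_eqVlt; apply/orP; left; apply/eqP.
  rewrite [(2 * level n j) ^+ _]exprMn [level n j ^+ P.+2]exprS.
  have -> : (b / level n j * `|f y|) ^+ P.+1 = (b * `|f y|) ^+ P.+1 / level n j ^+ P.+1.
    by rewrite mulrAC exprMn exprVn.
  have : level n j ^+ P.+1 != 0 :> R by rewrite expf_neq0// gt_eqF.
  move: (level n j ^+ P.+1) (2 ^+ P.+2) ((b * `|f y|) ^+ P.+1) => u v z u0.
  by field.
rewrite -ge0_sume_distrr; last by move=> j _; apply: integral_ge0 => y _; rewrite lee_fin.
have [K2 K20 K2E] : exists2 K2, 0 <= K2 & K2 = 2 ^+ P.+3 * b ^+ P.+2.
  by eexists; last reflexivity; rewrite mulr_ge0// exprn_ge0// ltW.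
rewrite -[C * _ * _]mulrA -K2E [in leRHS]EFinM -muleA lee_wpmul2l ?lee_fin//.
rewrite -ge0_integral_sum//; last by move=> j y _; rewrite lee_fin.
rewrite -ge0_integralZl_EFin//; last first.
  apply/measurable_EFinP; apply: (@measurableT_comp _ _ _ _ _ _ (fun z : R => z `^ P.+2%:R)) mabs.
  exact: measurable_powR.
apply: ge0_le_integral_nonmeas => y _; first by rewrite sume_ge0// => j _; rewrite lee_fin.
rewrite sumEFin -EFinM lee_fin powR_mulrn// -mulr_suml -mulr_sumr K2E.
have := level_sum_le n (w0 y).
move=> /(ler_wpM2l (exprn_ge0 P.+2 (ler0n R 2))) /(ler_wpM2r (exprn_ge0 P.+1 (w0 y))).
move=> /le_trans; apply; rewrite le_eqVlt; apply/orP; left; apply/eqP.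
rewrite /w [2 ^+ P.+3]exprS [b ^+ P.+2]exprS [`|f y| ^+ P.+2]exprS exprMn.
move: (2 ^+ P.+2) (b ^+ P.+1) (`|f y| ^+ P.+1) => u v z; ring.
Qed.

End strong_type.

(** * Vanishing measures, and the conclusion *)

Section degenerate.
Context {R : realType}.
Local Open Scope ereal_scope.

Lemma maxop_null (nu : {measure set R -> \bar R}) (f : R -> R) x :
  nu setT = 0 -> maxop nu f x = 0.
Proof.
move=> nu0; apply/eqP; rewrite eq_le maxop_ge0 andbT.
apply: ge_ereal_sup => _ [ab _ <-].
have -> : nu `]ab.1, ab.2[%classic = 0.
  apply/eqP; rewrite -measure_le0 -nu0; apply: le_measure; rewrite ?inE//.
by rewrite /= invr0 mul0e.
Qed.

End degenerate.

Unset Implicit Arguments.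

Theorem mainTheorem5 (R : realType) (mu nu : {measure set R -> \bar R}) :
  radon mu -> radon nu -> doubling mu -> doubling nu ->
  (exists C : R, 1 <= C /\
     forall x r : R, 0 < r ->
       (\int[mu]_(y in oball x (2 * r)%R)
          \int[lebesgue_measure]_(t in `]0%R, (2 * r)%R[%classic)
             ((alpha mu nu (y - t)%R (y + t)%R) ^+ 2 * (t^-1)%R%:E)
        <= C%:E * mu (oball x r))%E) ->
  exists p : R, 1 < p /\
    exists K : R, forall f : R -> R, measurable_fun setT f ->
      (\int[mu]_x ((`|f x| `^ p)%:E) < +oo)%E ->
      (\int[mu]_x ((maxop nu f x) `^ p)
         <= K%:E * \int[mu]_x ((`|f x| `^ p)%:E))%E.
Proof.
move=> rmu rnu [Dm dm] [Dn dn] [C [C1 carl]].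
(* Tents have positive mass only for nonzero measures, so zero measures are treated first, with the
   arbitrary exponent 2. *)
have [mu0|mu0] := eqVneq (mu setT) 0%E.
  exists 2; split; first by rewrite ltr1n.
  exists 0 => f mf _; rewrite mul0e.
  rewrite (_ : (\int[mu]_x _)%E = 0%E)//.
  rewrite (eq_measure_integral mzero) ?integral_measure_zero// => A mA _.
  by apply/eqP; rewrite -measure_le0 -mu0; apply: le_measure; rewrite ?inE//.
(* For nu = 0 every average is 0, because the inverse of 0 is 0 by convention. *)
have [nu0|nu0] := eqVneq (nu setT) 0%E.
  exists 2; split; first by rewrite ltr1n.
  exists 0 => f mf _; rewrite mul0e integral0_eq// => x _.
  by rewrite maxop_null// poweR_EFin powR0// pnatr_eq0.
pose D := Num.max 1 (Num.max Dm Dn).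
have D1 : 1 <= D by rewrite le_max lexx.
have dmu : doubling_with mu D.
  by apply: (@doubling_withW _ _ Dm) dm; rewrite !le_max lexx !orbT.
have dnu : doubling_with nu D.
  by apply: (@doubling_withW _ _ Dn) dn; rewrite !le_max lexx !orbT.
pose c := (4 * D ^+ 3)^-1.
have D0 : 0 < D by exact: lt_le_trans D1.
have c0 : 0 < c by rewrite invr_gt0 mulr_gt0// exprn_gt0.
have rM : refining (mass mu setT) c by exact: mass_refining.
have rN : refining (mass nu setT) c by exact: mass_refining.
have C0 : 0 <= C by exact: le_trans C1.
pose K := carleson_const D C.
have Kb k x h : 0 < h -> cumul (mass mu setT) (chi2 (mass mu setT) (mass nu setT)) k x h <=
    K * mass mu setT x h.
  by move=> h0; exact: cumul_chi2_le.
pose e := bellman_eps c (3 * c^-1) K.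
have e0 : 0 < e.
  by apply: bellman_eps_gt0 => //; rewrite mulr_ge0// invr_ge0 ltW.
pose P := (Num.trunc (2 / e)).+1.
have Pe : 2 <= P%:R * e.
  by rewrite -ler_pdivrMr//; apply: ltW; exact: truncnS_gt.
have layer x h (g : R -> R) : 0 < h -> (forall y, 0 <= g y) -> measurable_fun setT g ->
  (\int[nu]_y (hat x h y * (g y * (1 < g y)%R%:R))%:E <=
  (mass nu setT x h / 2)%:E + (mass nu setT x h / mass mu setT x h * 4 ^+ P.+1)%:E *
     \int[mu]_y (hat x h y * (g y ^+ P.+1 * (1 < g y)%R%:R))%:E)%E.
  move=> h0 g0 mg; apply: (@hat_layer_bound _ mu nu P e) => //.
  - by have [] := rM x h h0.
  - by have [] := rN x h h0.
  - by move=> A l mA l0; exact: (mass_linear_bound rmu rnu c0 rM rN Kb).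
exists P.+2%:R; split; first by rewrite ltr1n.
(* The weak-type constant, then the factor 2^(P+3) b^(P+2) of the summation over levels with b = 4
   D. *)
exists (2 * D ^+ 3 * (2 * 4 ^+ P.+1) * 2 ^+ P.+3 * (4 * D) ^+ P.+2) => f mf _.
apply: maxop_strong_type => //.
- by rewrite mulr_gt0.
- apply: mulr_ge0; first by rewrite mulr_ge0// exprn_ge0// ltW.
  by rewrite mulr_ge0// exprn_ge0.
- move=> f' L mf' L0; exact: maxop_weak_type.
Qed.
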